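(* There is a computable position in infinite draughts such that Red has a computable strategy that wins against every computable strategy for Black and achieves at least a draw against every strategy for Black, while Black has a (necessarily noncomputable) strategy guaranteeing at least a draw. This holds in each of the three rule variants: with both the forced-jump and forced-iterated-jump rules; with the forced-jump rule only; and with neither.
   Context: Infinite draughts is played by two players, Black and Red, on the infinite checkerboard $\mathbb{Z}\times\mathbb{Z}$, using only the dark squares. A position consists of an arbitrary (possibly infinite) placement of pieces on dark squares, each a black or red pawn or king, together with which player is to move. Black pawns move only on upward diagonals, red pawns only downward; kings move in all four diagonal directions. Moves are simple one-step diagonal moves to empty squares, or jumps over a diagonally adjacent enemy piece to the empty square beyond, capturing (removing) it; iterated jumps by one piece count as one turn, and a piece making an infinite iterated jump is itself removed along with all jumped pieces. No promotion. Forced-jump rule: if a jump is available, one must jump. Forced-iterated-jump rule: the jumping piece must keep jumping while possible. A player with no legal move on their turn loses; infinite play is a draw. A position is computable if there is a computable procedure that, given any square, determines whether it is occupied and if so by which kind of piece (color and pawn/king). A strategy is computable if the move it prescribes is computable from the finite sequence of moves played so far (from the given computable position). *)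

(* Defs.v *)
From Stdlib Require Import ZArith List Arith Cantor.
Import ListNotations.
Open Scope Z_scope.

Inductive color := Black | Red.
Inductive kind := Pawn | King.
Definition piece : Type := (color * kind)%type.
Definition square : Type := (Z * Z)%type.
Definition board : Type := square -> option piece.

Record position := mkPosition { pboard : board; pturn : color }.

Definition opp (c : color) : color := match c with Black => Red | Red => Black end.

Definition dark (s : square) : Prop := Z.even (fst s + snd s) = true.
Definition dark_only (b : board) : Prop := forall s, ~ dark s -> b s = None.

Inductive dir := NE | NW | SE | SW.

Definition dvec (d : dir) : Z * Z :=
  match d with NE => (1, 1) | NW => (-1, 1) | SE => (1, -1) | SW => (-1, -1) end.

Definition shift (s : square) (d : dir) (k : Z) : square :=
  (fst s + k * fst (dvec d), snd s + k * snd (dvec d)).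

Definition allowed (pc : piece) (d : dir) : Prop :=
  match pc with
  | (_, King) => True
  | (Black, Pawn) => d = NE \/ d = NW
  | (Red, Pawn) => d = SE \/ d = SW
  end.

Definition sq_eqb (s t : square) : bool :=
  Z.eqb (fst s) (fst t) && Z.eqb (snd s) (snd t).

Definition upd (b : board) (s : square) (v : option piece) : board :=
  fun t => if sq_eqb t s then v else b t.

Definition jump_ok (b : board) (s : square) (pc : piece) (d : dir) : Prop :=
  allowed pc d /\
  (exists pc', b (shift s d 1) = Some pc' /\ fst pc' <> fst pc) /\
  b (shift s d 2) = None.

Definition do_jump (b : board) (s : square) (pc : piece) (d : dir) : board :=
  upd (upd (upd b s None) (shift s d 1) None) (shift s d 2) (Some pc).

(* A move: starting square, whether it is a jump move, and the sequence
   of directions (None = end of the sequence; an infinite iterated jump is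
   one whose path is never None). *)
Record move := mkMove { mfrom : square; mjump : bool; mpath : nat -> option dir }.

Fixpoint jstate (b0 : board) (s0 : square) (pc : piece) (p : nat -> option dir)
  (k : nat) : board * square :=
  match k with
  | O => (b0, s0)
  | S k' =>
      let st := jstate b0 s0 pc p k' in
      match p k' with
      | Some d => (do_jump (fst st) (snd st) pc d, shift (snd st) d 2)
      | None => st
      end
  end.

Inductive variant :=
  | BothRules
  | ForcedJumpOnly
  | NoForcing.

Definition forced_jump (v : variant) : Prop := v <> NoForcing.
Definition forced_iter (v : variant) : Prop := v = BothRules.

Definition jump_available (p : position) : Prop :=
  exists s pc d, pboard p s = Some pc /\ fst pc = pturn p /\ jump_ok (pboard p) s pc d.

Definition legal (v : variant) (p : position) (m : move) (p' : position) : Prop :=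
  let b := pboard p in
  let s := mfrom m in
  exists pc, b s = Some pc /\ fst pc = pturn p /\ pturn p' = opp (pturn p) /\
  (
    ( mjump m = false /\
      (exists d, mpath m 0%nat = Some d /\ (forall k, mpath m (S k) = None) /\
         allowed pc d /\ b (shift s d 1) = None /\
         (forall t, pboard p' t = upd (upd b s None) (shift s d 1) (Some pc) t)) /\
      (forced_jump v -> ~ jump_available p) )
  \/
    ( mjump m = true /\ mpath m 0%nat <> None /\
      (forall k, mpath m k = None -> mpath m (S k) = None) /\
      (forall k d, mpath m k = Some d ->
          jump_ok (fst (jstate b s pc (mpath m) k)) (snd (jstate b s pc (mpath m) k)) pc d) /\
      (
        (exists n, mpath m n = None /\
           (forall t, pboard p' t = fst (jstate b s pc (mpath m) n) t) /\
           (forced_iter v -> forall d,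
              ~ jump_ok (fst (jstate b s pc (mpath m) n)) (snd (jstate b s pc (mpath m) n)) pc d))
      \/
        ((forall n, mpath m n <> None) /\
         forall t,
           ((t = s \/ exists k d, mpath m k = Some d /\
                                  t = shift (snd (jstate b s pc (mpath m) k)) d 1) ->
              pboard p' t = None) /\
           (~ (t = s \/ exists k d, mpath m k = Some d /\
                                    t = shift (snd (jstate b s pc (mpath m) k)) d 1) ->
              pboard p' t = b t)) ) ) ).

Definition strategy : Type := list move -> move.

Definition dmove : move := mkMove (0, 0) false (fun _ => None).

Definition turn_at (t0 : color) (k : nat) : color :=
  if Nat.even k then t0 else opp t0.

Fixpoint hist (sB sR : strategy) (t0 : color) (n : nat) : list move :=
  match n with
  | O => []
  | S n' =>
      let h := hist sB sR t0 n' in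
      h ++ [ (match turn_at t0 n' with Black => sB | Red => sR end) h ]
  end.

Definition play_move (sB sR : strategy) (t0 : color) (k : nat) : move :=
  (match turn_at t0 k with Black => sB | Red => sR end) (hist sB sR t0 k).

(* Player c loses the play of sB (Black) against sR (Red) from p0: after n
   legal moves it is c's turn and c's strategy does not produce a legal move
   (in particular when c has no legal move at all).  A play in which nobody
   loses is infinite, i.e. a draw. *)
Definition loses (v : variant) (p0 : position) (sB sR : strategy) (c : color) : Prop :=
  exists (n : nat) (ps : nat -> position),
    ps 0%nat = p0 /\
    (forall k, (k < n)%nat -> legal v (ps k) (play_move sB sR (pturn p0) k) (ps (S k))) /\
    pturn (ps n) = c /\
    ~ (exists p', legal v (ps n) (play_move sB sR (pturn p0) n) p').

Inductive code :=
  | CZero | CSucc | CId | CFst | CSnd | COrc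
  | CPair (f g : code)
  | CComp (f g : code)
  | CRec (f g : code)
  | CMu (f : code).

Local Notation pr a b := (Cantor.to_nat (a, b)%nat).
Local Open Scope nat_scope.

Inductive ev (o : nat -> nat) : code -> nat -> nat -> Prop :=
  | ev_zero x : ev o CZero x 0
  | ev_succ x : ev o CSucc x (S x)
  | ev_id x : ev o CId x x
  | ev_fst a b : ev o CFst (pr a b) a
  | ev_snd a b : ev o CSnd (pr a b) b
  | ev_orc x : ev o COrc x (o x)
  | ev_pair f g x y z : ev o f x y -> ev o g x z -> ev o (CPair f g) x (pr y z)
  | ev_comp f g x y z : ev o g x y -> ev o f y z -> ev o (CComp f g) x z
  | ev_rec0 f g a y : ev o f a y -> ev o (CRec f g) (pr a 0) y
  | ev_recS f g a n y z :
      ev o (CRec f g) (pr a n) y -> ev o g (pr a (pr n y)) z ->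
      ev o (CRec f g) (pr a (S n)) z
  | ev_mu f x n (val : nat -> nat) :
      ev o f (pr x n) 0 ->
      (forall m, m < n -> ev o f (pr x m) (S (val m))) ->
      ev o (CMu f) x n.

Definition enc_Z (z : Z) : nat :=
  Z.to_nat (if Z.leb 0 z then 2 * z else - 2 * z - 1)%Z.
Definition enc_sq (s : square) : nat := pr (enc_Z (fst s)) (enc_Z (snd s)).
Definition enc_content (c : option piece) : nat :=
  match c with
  | None => 0
  | Some (Black, Pawn) => 1 | Some (Black, King) => 2
  | Some (Red, Pawn) => 3 | Some (Red, King) => 4
  end.
Definition enc_dopt (d : option dir) : nat :=
  match d with None => 0 | Some NE => 1 | Some NW => 2 | Some SE => 3 | Some SW => 4 end.
Definition enc_move (m : move) (n : nat) : nat :=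
  match n with
  | O => enc_sq (mfrom m)
  | 1 => if mjump m then 1 else 0
  | S (S k) => enc_dopt (mpath m k)
  end.
Definition enc_hist (h : list move) (x : nat) : nat :=
  match x with
  | O => length h
  | S y => let '(i, k) := Cantor.of_nat y in enc_move (nth i h dmove) k
  end.

(* A position is computable if its board is computable square by square
   (the side to move is a single bit). *)
Definition computable_position (p : position) : Prop :=
  exists c, forall s, ev (fun _ => 0) c (enc_sq s) (enc_content (pboard p s)).

(* A strategy is computable if the prescribed move is computable from the
   sequence of moves played so far (type-2 / oracle computation, since a
   move -- an infinite iterated jump -- may be an infinite object). *)
Definition computable_strategy (sg : strategy) : Prop :=
  exists c, forall h n, ev (enc_hist h) c n (enc_move (sg h) n).

(* Main.v *)
From Stdlib Require Import ZArith List Arith Lia ZifyNat Bool Cantor Wf_nat Classical ClassicalEpsilon.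
Require Import Defs.
Import ListNotations.
Local Open Scope nat_scope.

(** Fill part of the board with immobile black pawns, the rest with red ones, and
    leave one empty square, the hole.  A black pawn just below the hole may step
    into it, so Black's only moves let the hole walk downwards, to the left or to
    the right, inside the black region.  That region is a thickened planar drawing
    of a computable infinite binary tree without computable branches: the branch
    must disagree, at depth e, with the output of the e-th machine on input e.
    A play that Black survives traces an infinite branch.  Corridors are three
    squares wide, so that Black never has a jump, and a hole that keeps to their
    lower side has two rows of black pawns above it, where no red piece can reach it.
    Far away Red has infinitely many captures in store, which serve as tempo moves
    (and, if jumping is compulsory, are all that Red can ever play).
    Against this strategy the history is determined by the walk of the hole, so a
    computable strategy for Black would yield a computable branch. *)

(** * Computable functions and a universal machine *)

Arguments Cantor.to_nat : simpl never.
Arguments Cantor.of_nat : simpl never.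

Local Notation cp a b := (Cantor.to_nat (a, b)).

(** The board must be decidable square by square, although it is undecidable whether machine [e]
    halts on input [e]. So a node [m] inspects only the first [m] steps of each run: a wrong
    decision may be followed by a long black region before it is noticed, but along an infinite
    branch the numbers [m] are unbounded, and every wrong decision is noticed in the end. Hence the
    tree is computable, and its infinite branches are exactly as hard as the diagonal problem
    demands; one of them is obtained by excluded middle. One position and one pair of strategies
    serve all three variants. The variants differ in what is known about the board when Red is
    arbitrary. With compulsory jumps Red can do nothing but use up gadgets, so the board keeps an
    exact shape, from which it follows that Black is never obliged to jump. Without them Red may
    rearrange everything outside the quadrant, and the weaker invariant [agree] records only what
    Black's walk relies on. *)

Definition pi1 (n : nat) : nat := fst (Cantor.of_nat n).
Definition pi2 (n : nat) : nat := snd (Cantor.of_nat n).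

Lemma pi1_cp (a b : nat) : pi1 (cp a b) = a.
Proof. unfold pi1. now rewrite Cantor.cancel_of_to. Qed.

Lemma pi2_cp (a b : nat) : pi2 (cp a b) = b.
Proof. unfold pi2. now rewrite Cantor.cancel_of_to. Qed.

Lemma cp_pi (n : nat) : cp (pi1 n) (pi2 n) = n.
Proof. unfold pi1, pi2. rewrite <- surjective_pairing. apply Cantor.cancel_to_of. Qed.

(** The same code has to work for every oracle: such functions are run with the zero oracle for the
    position and the diagonal machine, and with the history as oracle inside a strategy. *)
Definition comp (f : nat -> nat) : Prop := exists c, forall o x, ev o c x (f x).
Definition comp2 (f : nat -> nat -> nat) : Prop := comp (fun z => f (pi1 z) (pi2 z)).
Definition comp3 (f : nat -> nat -> nat -> nat) : Prop :=
  comp (fun z => f (pi1 z) (pi1 (pi2 z)) (pi2 (pi2 z))).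

Lemma comp_ext (f g : nat -> nat) : (forall x, f x = g x) -> comp f -> comp g.
Proof. intros E [c H]. exists c. intros o x. rewrite <- E. apply H. Qed.

Lemma comp_id : comp (fun x => x).
Proof. exists CId. constructor. Qed.

Lemma comp_pair (f g : nat -> nat) : comp f -> comp g -> comp (fun x => cp (f x) (g x)).
Proof. intros [c H] [d K]. exists (CPair c d). intros o x. constructor; auto. Qed.

Lemma comp_comp (g f : nat -> nat) : comp g -> comp f -> comp (fun x => g (f x)).
Proof. intros [c H] [d K]. exists (CComp c d). intros o x. econstructor; eauto. Qed.

Lemma comp_comp2 (h : nat -> nat -> nat) (f g : nat -> nat) :
  comp2 h -> comp f -> comp g -> comp (fun x => h (f x) (g x)).
Proof.
  intros H F G. apply comp_ext with (2 := comp_comp _ _ H (comp_pair _ _ F G)).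
  intros x. now rewrite pi1_cp, pi2_cp.
Qed.

Lemma comp_comp3 (h : nat -> nat -> nat -> nat) (f g k : nat -> nat) :
  comp3 h -> comp f -> comp g -> comp k -> comp (fun x => h (f x) (g x) (k x)).
Proof.
  intros H F G K.
  apply comp_ext with (2 := comp_comp _ _ H (comp_pair _ _ F (comp_pair _ _ G K))).
  intros x. now rewrite !pi2_cp, !pi1_cp.
Qed.

Lemma comp_S : comp S.
Proof. exists CSucc. constructor. Qed.

Lemma comp_pi1 : comp pi1.
Proof. exists CFst. intros o x. rewrite <- (cp_pi x) at 1. constructor. Qed.

Lemma comp_pi2 : comp pi2.
Proof. exists CSnd. intros o x. rewrite <- (cp_pi x) at 1. constructor. Qed.

Lemma comp_const (n : nat) : comp (fun _ => n).
Proof.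
  induction n as [|n IH].
  - exists CZero. constructor.
  - exact (comp_comp _ _ comp_S IH).
Qed.

Lemma comp_rec (a N : nat -> nat) (g : nat -> nat -> nat -> nat) :
  comp a -> comp N -> comp3 g ->
  comp (fun x => nat_rect (fun _ => nat) (a x) (fun n y => g x n y) (N x)).
Proof.
  intros [ca Ha] [cn Hn] [cg Hg].
  exists (CComp (CRec ca cg) (CPair CId cn)). intros o x.
  apply ev_comp with (cp x (N x)); [now repeat constructor|].
  induction (N x) as [|m IH]; cbn.
  - now constructor.
  - apply ev_recS with (1 := IH).
    pose proof (Hg o (cp x (cp m (nat_rect (fun _ => nat) (a x) (fun n y => g x n y) m)))) as K.
    now rewrite !pi2_cp, !pi1_cp in K.
Qed.

(** The function [g] is known beforehand as the least zero of [f], so the search is total; [pred]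
    provides the nonzero values that [ev_mu] asks for on the way. *)
Lemma comp_mu (f : nat -> nat -> nat) (g : nat -> nat) :
  comp2 f -> (forall x, f x (g x) = 0) -> (forall x m, m < g x -> f x m <> 0) -> comp g.
Proof.
  intros [c H] Z NZ. exists (CMu c). intros o x.
  apply ev_mu with (fun m => pred (f x m)).
  - rewrite <- (Z x). pose proof (H o (cp x (g x))) as K. now rewrite pi1_cp, pi2_cp in K.
  - intros m Hm. pose proof (H o (cp x m)) as K. rewrite pi1_cp, pi2_cp in K.
    rewrite Nat.succ_pred; auto.
Qed.

Definition sw (n a b : nat) : nat := match n with 0 => a | S _ => b end.

Lemma comp3_sw : comp3 sw.
Proof.
  unfold comp3.
  apply comp_ext with (fun z => nat_rect (fun _ => nat) (pi1 (pi2 z)) 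
     (fun n y => (fun z n y => pi2 (pi2 z)) z n y) (pi1 z)).
  - intros z. now destruct (pi1 z).
  - apply comp_rec.
    + apply (comp_comp pi1); auto using comp_pi1, comp_pi2.
    + apply comp_pi1.
    + exact (comp_comp _ _ comp_pi2 (comp_comp _ _ comp_pi2 comp_pi1)).
Qed.

Create HintDb comp discriminated.
#[export] Hint Resolve comp_S comp_pi1 comp_pi2 comp3_sw : comp.

(** The patterns go from special to general, since the last ones match any application. The
    recursive call is a parameter, so that the richer [comp_auto] can reuse these cases. *)
Ltac comp_with k :=
  lazymatch goal with
  | |- comp2 _ => first [solve [auto 1 with comp nocore] | unfold comp2; cbn beta; k tt]
  | |- comp3 _ => first [solve [auto 1 with comp nocore] | unfold comp3; cbn beta; k tt]
  | |- comp (fun x => x) => apply comp_id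
  | |- comp (fun _ => ?c) => apply (comp_const c)
  | |- comp (fun x => Cantor.to_nat (@?f x, @?g x)) => apply (comp_pair f g); k tt
  | |- comp (fun x => nat_rect (fun _ => nat) (@?a x) (fun n y => @?g x n y) (@?N x)) =>
      apply (comp_rec a N g); k tt
  | |- comp (fun x => ?h (@?f x) (@?g x) (@?e x)) =>
      apply (comp_comp3 h f g e); [solve [auto 1 with comp nocore] | k tt ..]
  | |- comp (fun x => ?h (@?f x) (@?g x)) =>
      apply (comp_comp2 h f g); [solve [auto 1 with comp nocore] | k tt ..]
  | |- comp (fun x => ?h (@?f x)) =>
      apply (comp_comp h f); [solve [auto 1 with comp nocore] | k tt]
  | |- comp _ => solve [auto 1 with comp nocore]
  end.

Ltac comp_arith := comp_with ltac:(fun _ => comp_arith).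

Lemma comp_pred : comp pred.
Proof.
  apply comp_ext with (fun z => nat_rect (fun _ => nat) 0 (fun n y => n) z).
  - now intros [|z].
  - comp_arith.
Qed.
#[export] Hint Resolve comp_pred : comp.

Lemma comp2_add : comp2 Nat.add.
Proof.
  unfold comp2.
  apply comp_ext with (fun z => nat_rect (fun _ => nat) (pi2 z) (fun n y => S y) (pi1 z)).
  - intros z. induction (pi1 z) as [|m IH]; cbn; congruence.
  - comp_arith.
Qed.
#[export] Hint Resolve comp2_add : comp.

Lemma comp2_mul : comp2 Nat.mul.
Proof.
  unfold comp2.
  apply comp_ext with (fun z => nat_rect (fun _ => nat) 0 (fun n y => pi2 z + y) (pi1 z)).
  - intros z. induction (pi1 z) as [|m IH]; cbn; congruence.
  - comp_arith.
Qed.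
#[export] Hint Resolve comp2_mul : comp.

Lemma comp2_sub : comp2 Nat.sub.
Proof.
  unfold comp2.
  apply comp_ext with (fun z => nat_rect (fun _ => nat) (pi1 z) (fun n y => pred y) (pi2 z)).
  - intros z. induction (pi2 z) as [|m IH]; cbn; lia.
  - comp_arith.
Qed.
#[export] Hint Resolve comp2_sub : comp.

Lemma comp2_div : comp2 Nat.div.
Proof.
  (* By convention [x / 0] is 0, whereas the search for a quotient needs a positive divisor; the
     inner [sw] replaces the divisor 0 by 1. *)
  apply comp_ext with (fun z => sw (pi2 z) 0 (pi1 z / sw (pi2 z) 1 (pi2 z))).
  { intros z. now destruct (pi2 z). }
  apply (comp_comp3 sw); auto with comp; [apply comp_const|].
  assert (Hd : forall z, sw (pi2 z) 1 (pi2 z) <> 0) by (intros z; now destruct (pi2 z)).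
  apply comp_mu with (fun z q => S (pi1 z) - sw (pi2 z) 1 (pi2 z) * S q).
  - comp_arith.
  - intros z. pose proof (Nat.mul_succ_div_gt (pi1 z) _ (Hd z)). lia.
  - intros z m Hm. pose proof (Nat.Div0.mul_div_le (pi1 z) (sw (pi2 z) 1 (pi2 z))).
    specialize (Hd z). nia.
Qed.
#[export] Hint Resolve comp2_div : comp.

Lemma comp2_mod : comp2 Nat.modulo.
Proof.
  apply comp_ext with (fun z => pi1 z - pi2 z * (pi1 z / pi2 z)); [|comp_arith].
  intros z. pose proof (Nat.div_mod_eq (pi1 z) (pi2 z)). lia.
Qed.
#[export] Hint Resolve comp2_mod : comp.

Lemma comp2_pow : comp2 Nat.pow.
Proof.
  apply comp_ext with (fun z => nat_rect (fun _ => nat) 1 (fun n y => pi1 z * y) (pi2 z)); [|comp_arith].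
  intros z. induction (pi2 z) as [|m IH]; cbn; congruence.
Qed.
#[export] Hint Resolve comp2_pow : comp.

Lemma comp_log2 : comp Nat.log2.
Proof.
  (* The least [n] with [x < 2 ^ (n + 1)]; this is right for [x = 0] too, where [Nat.log2] is 0. *)
  apply comp_mu with (fun x n => S x - 2 ^ S n).
  - comp_arith.
  - intros x. destruct (Nat.eq_dec x 0) as [->|]; [reflexivity|].
    pose proof (Nat.log2_spec x). lia.
  - intros x m Hm. destruct (Nat.eq_dec x 0) as [->|]; [cbn in Hm; lia|].
    pose proof (Nat.log2_spec x). pose proof (Nat.pow_le_mono_r 2 (S m) (Nat.log2 x)). lia.
Qed.
#[export] Hint Resolve comp_log2 : comp.

Lemma comp_if (b : nat -> bool) (f g : nat -> nat) :
  comp (fun x => Nat.b2n (b x)) -> comp f -> comp g -> comp (fun x => if b x then f x else g x).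
Proof.
  intros B F G. apply comp_ext with (fun x => sw (Nat.b2n (b x)) (g x) (f x)).
  - intros x. now destruct (b x).
  - now apply (comp_comp3 sw); auto with comp.
Qed.

Lemma comp_leb (f g : nat -> nat) : comp f -> comp g -> comp (fun x => Nat.b2n (f x <=? g x)).
Proof.
  intros F G. apply comp_ext with (fun x => sw (f x - g x) 1 0).
  - intros x. destruct (Nat.leb_spec (f x) (g x)); destruct (f x - g x) eqn:E; cbn; lia.
  - apply (comp_comp3 sw); auto using comp_const with comp.
    now apply (comp_comp2 Nat.sub); auto with comp.
Qed.

Lemma comp_eqb (f g : nat -> nat) : comp f -> comp g -> comp (fun x => Nat.b2n (f x =? g x)).
Proof.
  intros F G. apply comp_ext with (fun x => sw ((f x - g x) + (g x - f x)) 1 0).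
  - intros x. destruct (Nat.eqb_spec (f x) (g x)); destruct (f x - g x + (g x - f x)) eqn:E; cbn; lia.
  - apply (comp_comp3 sw); auto using comp_const with comp.
    apply (comp_comp2 Nat.add); auto with comp; now apply (comp_comp2 Nat.sub); auto with comp.
Qed.

Lemma comp_andb (a b : nat -> bool) : comp (fun x => Nat.b2n (a x)) ->
  comp (fun x => Nat.b2n (b x)) -> comp (fun x => Nat.b2n (a x && b x)).
Proof.
  intros A B. apply comp_ext with (fun x => if a x then Nat.b2n (b x) else 0).
  - intros x. now destruct (a x).
  - apply comp_if; auto using comp_const.
Qed.

Lemma comp_negb (a : nat -> bool) : comp (fun x => Nat.b2n (a x)) ->
  comp (fun x => Nat.b2n (negb (a x))).
Proof.
  intros A. apply comp_ext with (fun x => if a x then 0 else 1).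
  - intros x. now destruct (a x).
  - apply comp_if; auto using comp_const.
Qed.

Lemma comp_orb (a b : nat -> bool) : comp (fun x => Nat.b2n (a x)) ->
  comp (fun x => Nat.b2n (b x)) -> comp (fun x => Nat.b2n (a x || b x)).
Proof.
  intros A B. apply comp_ext with (fun x => if a x then 1 else Nat.b2n (b x)).
  - intros x. now destruct (a x).
  - apply comp_if; auto using comp_const.
Qed.

Ltac comp_auto :=
  lazymatch goal with
  | |- comp (fun x => if @?b x then @?f x else @?g x) => apply (comp_if b f g); comp_auto
  | |- comp (fun x => Nat.b2n (@?f x =? @?g x)) => apply (comp_eqb f g); comp_auto
  | |- comp (fun x => Nat.b2n (@?f x <=? @?g x)) => apply (comp_leb f g); comp_auto
  | |- comp (fun x => Nat.b2n (@?f x <? @?g x)) => apply (comp_leb (fun x => S (f x)) g); comp_auto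
  | |- comp (fun x => Nat.b2n (@?f x && @?g x)) => apply (comp_andb f g); comp_auto
  | |- comp (fun x => Nat.b2n (@?f x || @?g x)) => apply (comp_orb f g); comp_auto
  | |- comp (fun x => Nat.b2n (negb (@?f x))) => apply (comp_negb f); comp_auto
  | |- comp (fun x => Nat.b2n (?h (@?f x))) =>
      apply (comp_comp (fun y => Nat.b2n (h y)) f); [solve [auto 1 with comp nocore] | comp_auto]
  | |- comp (fun x => Nat.b2n (?h (@?f x) (@?g x))) =>
      apply (comp_comp2 (fun y z => Nat.b2n (h y z)) f g); [solve [auto 1 with comp nocore] | comp_auto ..]
  | |- comp2 _ => unfold comp2; cbn beta; comp_auto
  | |- _ => comp_with ltac:(fun _ => comp_auto)
  end.

(** * A universal machine with an explicit stack *)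

Fixpoint enc (c : code) : nat :=
  match c with
  | CZero => cp 0 0 | CSucc => cp 1 0 | CId => cp 2 0
  | CFst => cp 3 0 | CSnd => cp 4 0 | COrc => cp 5 0
  | CPair f g => cp 6 (cp (enc f) (enc g))
  | CComp f g => cp 7 (cp (enc f) (enc g))
  | CRec f g => cp 8 (cp (enc f) (enc g))
  | CMu f => cp 9 (enc f)
  end.

(* Abstract machine on natural numbers: [meval c x K] evaluates code [c] at [x]
   with stack [K]; [mret y K] returns [y] to [K].  The empty stack is 0 = cp 0 0,
   and the oracle is constantly 0. *)
Definition meval (c x K : nat) : nat := cp 0 (cp c (cp x K)).
Definition mret (y K : nat) : nat := cp 1 (cp y K).

Definition estep (c x K : nat) : nat :=
  let t := pi1 c in let b := pi2 c in
  sw t (mret 0 K)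
  (sw (t - 1) (mret (S x) K)
  (sw (t - 2) (mret x K)
  (sw (t - 3) (mret (pi1 x) K)
  (sw (t - 4) (mret (pi2 x) K)
  (sw (t - 5) (mret 0 K)
  (sw (t - 6) (meval (pi1 b) x (cp 1 (cp (cp (pi2 b) x) K)))
  (sw (t - 7) (meval (pi2 b) x (cp 3 (cp (pi1 b) K)))
  (sw (t - 8)
     (sw (pi2 x) (meval (pi1 b) (pi1 x) K)
        (meval c (cp (pi1 x) (pred (pi2 x)))
           (cp 4 (cp (cp (pi2 b) (cp (pi1 x) (pred (pi2 x)))) K))))
     (meval b (cp x 0) (cp 5 (cp (cp b (cp x 0)) K))))))))))).

(** The tag of the top frame says what [y] was awaited for: 1 and 2 the first and second component
    of a pair, 3 the inner function of a composition, 4 the previous value of a recursion, 5 a test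
    in a minimisation. [D] is what was saved to resume. Tag 0 is the empty stack, on which the
    machine idles. *)
Definition rstep (y K : nat) : nat :=
  let t := pi1 K in let D := pi1 (pi2 K) in let K' := pi2 (pi2 K) in
  sw t (mret y K)
  (sw (t - 1) (meval (pi1 D) (pi2 D) (cp 2 (cp y K')))
  (sw (t - 2) (mret (cp D y) K')
  (sw (t - 3) (meval D y K')
  (sw (t - 4) (meval (pi1 D) (cp (pi1 (pi2 D)) (cp (pi2 (pi2 D)) y)) K')
     (sw y (mret (pi2 (pi2 D)) K')
        (let D' := cp (pi1 (pi2 D)) (S (pi2 (pi2 D))) in
         meval (pi1 D) D' (cp 5 (cp (cp (pi1 D) D') K')))))))).

Definition mstep (s : nat) : nat :=
  sw (pi1 s) (estep (pi1 (pi2 s)) (pi1 (pi2 (pi2 s))) (pi2 (pi2 (pi2 s))))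
     (rstep (pi1 (pi2 s)) (pi2 (pi2 s))).

Fixpoint mrun (n s : nat) : nat :=
  match n with 0 => s | S n => mstep (mrun n s) end.

Lemma comp2_mret : comp2 mret.
Proof. unfold mret. comp_arith. Qed.
Lemma comp3_meval : comp3 meval.
Proof. unfold meval. comp_arith. Qed.
#[export] Hint Resolve comp2_mret comp3_meval : comp.
Lemma comp3_estep : comp3 estep.
Proof. unfold estep. comp_arith. Qed.
Lemma comp2_rstep : comp2 rstep.
Proof. unfold rstep. comp_arith. Qed.
#[export] Hint Resolve comp3_estep comp2_rstep : comp.
Lemma comp_mstep : comp mstep.
Proof. unfold mstep. comp_arith. Qed.
#[export] Hint Resolve comp_mstep : comp.
Lemma comp2_mrun : comp2 mrun.
Proof.
  apply comp_ext with (fun z => nat_rect (fun _ => nat) (pi2 z) (fun n y => mstep y) (pi1 z)); [|comp_arith].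
  intros z. induction (pi1 z) as [|n IH]; cbn; congruence.
Qed.
#[export] Hint Resolve comp2_mrun : comp.

Lemma mrun_add (n m s : nat) : mrun (n + m) s = mrun n (mrun m s).
Proof. induction n as [|n IH]; cbn; congruence. Qed.

Lemma mstep_eval (c x K : nat) : mstep (meval c x K) = estep c x K.
Proof. unfold mstep, meval. now rewrite !pi2_cp, !pi1_cp. Qed.

Lemma mstep_ret (y K : nat) : mstep (mret y K) = rstep y K.
Proof. unfold mstep, mret. now rewrite !pi2_cp, !pi1_cp. Qed.

Definition reach (s s' : nat) : Prop := exists n, mrun n s = s'.

Lemma reach_refl (s : nat) : reach s s.
Proof. now exists 0. Qed.

Lemma reach_trans (s1 s2 s3 : nat) : reach s1 s2 -> reach s2 s3 -> reach s1 s3.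
Proof. intros [n <-] [m <-]. exists (m + n). apply mrun_add. Qed.

Lemma reach_step (s1 s2 : nat) : reach (mstep s1) s2 -> reach s1 s2.
Proof. apply reach_trans. now exists 1. Qed.

Ltac mstep1 :=
  apply reach_step; rewrite ?mstep_eval, ?mstep_ret; unfold estep, rstep;
  cbn [enc]; repeat rewrite ?pi1_cp, ?pi2_cp; cbn [sw Nat.sub pred].

(** The stack is quantified inside the induction, so that a subcomputation may run on top of the
    frames of its caller. *)
Lemma machine_complete (c : code) (x y : nat) :
  ev (fun _ => 0) c x y -> forall K, reach (meval (enc c) x K) (mret y K).
Proof.
  induction 1 as [x|x|x|a b|a b|x|f g x y z Hf IHf Hg IHg|f g x y z Hg IHg Hf IHf
    |f g a y Hf IHf|f g a n y z Hr IHr Hg IHg|f x n val H0 IH0 Hm IHm]; intros K.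
  - mstep1. apply reach_refl.
  - mstep1. apply reach_refl.
  - mstep1. apply reach_refl.
  - mstep1. apply reach_refl.
  - mstep1. apply reach_refl.
  - mstep1. apply reach_refl.
  - mstep1. eapply reach_trans; [apply IHf|]. mstep1.
    eapply reach_trans; [apply IHg|]. mstep1. apply reach_refl.
  - mstep1. eapply reach_trans; [apply IHg|]. mstep1. apply IHf.
  - mstep1. apply IHf.
  - mstep1. eapply reach_trans; [apply (IHr (cp 4 _))|]. mstep1. apply IHg.
  - mstep1.
    (* A search resumed at candidate [m] is pulled back, one failed candidate at a time, to the
       search started at 0. *)
    assert (L : forall m, m <= n ->
      reach (meval (enc f) (cp x m) (cp 5 (cp (cp (enc f) (cp x m)) K))) (mret n K) ->
      reach (meval (enc f) (cp x 0) (cp 5 (cp (cp (enc f) (cp x 0)) K))) (mret n K)).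
    { induction m as [|m IH]; [auto|]. intros Hle R. apply IH; [lia|].
      eapply reach_trans; [apply IHm; lia|]. mstep1. exact R. }
    apply (L n); [lia|]. eapply reach_trans; [apply IH0|]. mstep1. apply reach_refl.
Qed.

Definition halt (y : nat) : nat := mret y 0.

(** The empty stack 0 is [cp 0 0] and so has tag 0, for which [rstep] returns the state unchanged. A
    result, once reached, is thus visible at every later time. *)
Lemma halt_stuck (n y : nat) : mrun n (halt y) = halt y.
Proof.
  induction n as [|n IH]; [reflexivity|]. cbn. rewrite IH. unfold halt.
  rewrite mstep_ret. unfold rstep. change 0 with (cp 0 0) at 1. now rewrite pi1_cp.
Qed.

Lemma halt_inj (a b : nat) : halt a = halt b -> a = b.
Proof.
  intros E. apply (f_equal (fun s => pi1 (pi2 s))) in E. unfold halt, mret in E.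
  now rewrite !pi2_cp, !pi1_cp in E.
Qed.

Definition selfrun (e n : nat) : nat := mrun n (meval e e 0).

Lemma selfrun_mono (e n m y : nat) : selfrun e n = halt y -> n <= m -> selfrun e m = halt y.
Proof.
  unfold selfrun. intros H L. replace m with ((m - n) + n) by lia.
  rewrite mrun_add, H. apply halt_stuck.
Qed.

Lemma selfrun_unique (e n m y z : nat) : selfrun e n = halt y -> selfrun e m = halt z -> y = z.
Proof.
  intros H K. apply halt_inj.
  rewrite <- (selfrun_mono e n (n + m) y H), <- (selfrun_mono e m (n + m) z K); lia.
Qed.

(* The oracle is replaced by a function computed from a parameter [p], which is
   carried along as the first component of the input. *)
Lemma oracle_subst (F : nat -> nat -> nat) (c : code) :
  comp2 F ->
  exists c', forall o p x y, (forall n, o n = F p n) ->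
    ev o c x y -> forall o', ev o' c' (cp p x) y.
Proof.
  intros [cF HF].
  set (sub := fix sub (c : code) : code :=
    match c with
    | CZero => CZero | CSucc => CComp CSucc CSnd | CId => CSnd
    | CFst => CComp CFst CSnd | CSnd => CComp CSnd CSnd | COrc => cF
    | CPair f g => CPair (sub f) (sub g)
    | CComp f g => CComp (sub f) (CPair CFst (sub g))
    | CRec f g =>
        CComp (CRec (sub f)
                 (CComp (sub g) (CPair (CComp CFst CFst) (CPair (CComp CSnd CFst) CSnd))))
          (CPair (CPair CFst (CComp CFst CSnd)) (CComp CSnd CSnd))
    | CMu f =>
        CMu (CComp (sub f) (CPair (CComp CFst CFst) (CPair (CComp CSnd CFst) CSnd)))
    end).
  exists (sub c). intros o p x y Ho E o'.
  assert (S2 : forall w u, ev o' (CPair (CComp CFst CFst) (CPair (CComp CSnd CFst) CSnd))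
                 (cp (cp p u) w) (cp p (cp u w))).
  { intros w u. repeat (econstructor; try constructor). }
  (* The derivation of a recursion at [S n] uses the recursion at [n], which is translated by the
     bare [CRec] on regrouped arguments and not by its wrapped form [sub (CRec f g)]. The induction
     therefore carries both. *)
  enough (ev o' (sub c) (cp p x) y /\
    match c with
    | CRec f g =>
        ev o' (CRec (sub f)
                 (CComp (sub g) (CPair (CComp CFst CFst) (CPair (CComp CSnd CFst) CSnd))))
           (cp (cp p (pi1 x)) (pi2 x)) y
    | _ => True end) by tauto.
  assert (R : forall a n z f g, ev o' (CRec (sub f)
                 (CComp (sub g) (CPair (CComp CFst CFst) (CPair (CComp CSnd CFst) CSnd))))
           (cp (cp p a) n) z -> ev o' (sub (CRec f g)) (cp p (cp a n)) z).
  { intros a n z f g H. eapply ev_comp; [|exact H].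
    repeat (econstructor; try constructor). }
  induction E as [x|x|x|a b|a b|x|f g x y z Hf IHf Hg IHg|f g x y z Hg IHg Hf IHf
    |f g a y Hf IHf|f g a n y z Hr IHr Hg IHg|f x n val H0 IH0 Hm IHm];
    (split; [|try exact I]).
  - constructor.
  - econstructor; constructor.
  - constructor.
  - econstructor; constructor.
  - econstructor; constructor.
  - cbn [sub]. rewrite Ho. pose proof (HF o' (cp p x)) as K. now rewrite pi1_cp, pi2_cp in K.
  - constructor; tauto.
  - eapply ev_comp; [|apply IHf]. constructor; [constructor|apply IHg].
  - apply R. constructor. apply IHf.
  - rewrite pi1_cp, pi2_cp. constructor. apply IHf.
  - apply R. destruct IHr as [_ K]. rewrite pi1_cp, pi2_cp in K.
    eapply ev_recS; [exact K|]. eapply ev_comp; [apply S2|]. apply IHg.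
  - rewrite pi1_cp, pi2_cp. destruct IHr as [_ K]. rewrite pi1_cp, pi2_cp in K.
    eapply ev_recS; [exact K|]. eapply ev_comp; [apply S2|]. apply IHg.
  - apply ev_mu with val.
    + eapply ev_comp; [apply S2|]. apply IH0.
    + intros m Hlt. eapply ev_comp; [apply S2|]. apply IHm; auto.
Qed.

(** * The tree and its planar drawing *)

(* Nodes of the binary tree are numbered as in a heap; [m / 2 ^ d] is the [d]-th
   ancestor of [m].  An ancestor at depth [e + 1] records the decision taken at
   depth [e], which must differ from the output of machine [e] on input [e]. *)
Definition killed (m d : nat) : bool :=
  (2 <=? m / 2 ^ d) &&
  (selfrun (Nat.log2 (m / 2 ^ d) - 1) m =? halt ((m / 2 ^ d) mod 2)).

Definition alive (m : nat) : bool := forallb (fun d => negb (killed m d)) (seq 0 m).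

Lemma comp_alive : comp (fun m => Nat.b2n (alive m)).
Proof.
  apply comp_ext with
    (fun m => nat_rect (fun _ => nat) 1 (fun d y => if killed m d then 0 else y) m).
  (* Here [m] is both the node and the bound on [d]; only the bound takes part in the induction. *)
  - intros m. unfold alive. generalize m at 1 3. intros n. induction m as [|d IH]; [reflexivity|].
    rewrite seq_S, forallb_app. cbn. rewrite IH.
    destruct (killed n d); cbn; now destruct (forallb _ _).
  - apply (comp_rec (fun _ => 1) (fun m => m) (fun m d y => if killed m d then 0 else y)).
    + comp_auto.
    + comp_auto.
    + unfold comp3, killed, selfrun, halt. cbn beta. comp_auto.
Qed.
#[export] Hint Resolve comp_alive : comp.

(** An ancestor that is at least 2 has [d < m], so the range checked by [alive] misses none. *)
Lemma alive_spec (m d : nat) :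
  alive m = true -> 2 <= m / 2 ^ d ->
  selfrun (Nat.log2 (m / 2 ^ d) - 1) m <> halt ((m / 2 ^ d) mod 2).
Proof.
  unfold alive. intros A L H. rewrite forallb_forall in A.
  assert (d < m).
  { pose proof (Nat.pow_gt_lin_r 2 d). pose proof (Nat.Div0.mul_div_le m (2 ^ d)). nia. }
  specialize (A d). rewrite in_seq in A. specialize (A ltac:(lia)).
  unfold killed in A. apply Nat.leb_le in L. rewrite L, H, Nat.eqb_refl in A. discriminate.
Qed.

(* Blocks of the plane, [i] increasing to the south-east and [j] to the south-west.
   A surviving node [m] occupies the column [i = 2 * m] until it branches.  Row
   [2 * p] carries the branching of node [brnode p], a corridor from column [2 * brnode p]
   to the columns of its two children.  [brnode] enumerates each level of the tree
   backwards, so that a corridor only passes above columns not yet started. *)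
Definition level_start (p : nat) : nat := 2 ^ Nat.log2 p.
Definition brnode (p : nat) : nat := 3 * level_start p - 1 - p.

Definition corridor (i j : nat) : bool :=
  (j mod 2 =? 0) && (2 * brnode (j / 2) <=? i) && (i <=? 4 * brnode (j / 2) + 2).
Definition label (i j : nat) : nat := if corridor i j then brnode (j / 2) else i / 2.
Definition block (i j : nat) : bool :=
  (2 <=? j) && alive (label i j) &&
  (corridor i j ||
   ((i mod 2 =? 0) && ((i / 2 <? brnode (j / 2)) || (2 * brnode (j / 2) <=? i / 2)))).

Lemma comp2_block : comp (fun z => Nat.b2n (block (pi1 z) (pi2 z))).
Proof. unfold block, label, corridor, brnode, level_start. comp_auto. Qed.

Lemma level_start_spec (p : nat) : 1 <= p -> level_start p <= p < 2 * level_start p.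
Proof. intros H. pose proof (Nat.log2_spec p H). unfold level_start. cbn [Nat.pow] in *. lia. Qed.

Lemma level_start_succ (p : nat) : 1 <= p ->
  (level_start (S p) = level_start p /\ S p < 2 * level_start p) \/ (level_start (S p) = 2 * level_start p /\ S p = 2 * level_start p).
Proof.
  intros H. pose proof (Nat.log2_spec p H). pose proof (Nat.log2_succ_or p) as [E|E].
  - right. pose proof (Nat.log2_spec (S p)). unfold level_start in *. rewrite E in *. cbn [Nat.pow] in *. lia.
  - left. pose proof (Nat.log2_spec (S p)). unfold level_start in *. rewrite E in *. cbn [Nat.pow] in *. lia.
Qed.

(** [above p] and [below p] describe the columns in use just before and just after the branching in
    row [2 * p]: the nodes of the current level still to branch, and the children of those that have
    branched. The latter fill the next level from its top, as the level is enumerated backwards. *)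
Definition above (p m : nat) : Prop := level_start p <= m <= brnode p \/ 2 * brnode p + 2 <= m < 4 * level_start p.
Definition below (p m : nat) : Prop := level_start p <= m < brnode p \/ 2 * brnode p <= m < 4 * level_start p.

(** Within a level [brnode] drops by one. At the end of a level no node is left to branch, and the
    children make up the whole next level. *)
Lemma above_succ (p m : nat) : 1 <= p -> below p m -> above (S p) m.
Proof.
  intros Hp. pose proof (level_start_spec p Hp). pose proof (level_start_succ p Hp).
  unfold above, below, brnode. lia.
Qed.

Lemma div2_even (p : nat) : 2 * p / 2 = p.
Proof. now rewrite Nat.mul_comm, Nat.div_mul. Qed.
Lemma div2_odd (p : nat) : (2 * p + 1) / 2 = p.
Proof. symmetry. now apply (Nat.div_unique _ 2 p 1); lia. Qed.
Lemma mod2_even (p : nat) : (2 * p) mod 2 = 0.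
Proof. now rewrite Nat.mul_comm, Nat.Div0.mod_mul. Qed.
Lemma mod2_odd (p : nat) : (2 * p + 1) mod 2 = 1.
Proof. symmetry. now apply (Nat.mod_unique _ 2 p 1); lia. Qed.

(** [block] checks no bounds of the level, so it also contains columns of nodes long past or not yet
    begun. This predicate, which ignores [alive], bounds what a monotone walk from the root can
    enter. *)
Definition on_branch (i j : nat) : Prop :=
  exists p, 1 <= p /\
  ((j = 2 * p + 1 /\ exists m, i = 2 * m /\ below p m) \/
   (j = 2 * p /\ (2 * brnode p <= i <= 4 * brnode p + 2 \/
                  exists m, i = 2 * m /\ above p m /\ m <> brnode p))).

Ltac zify_bool :=
  repeat match goal with
  | H : (_ && _)%bool = true |- _ => apply andb_prop in H; destruct H
  | H : (_ || _)%bool = true |- _ => apply orb_prop in H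
  | H : (_ <=? _) = true |- _ => apply Nat.leb_le in H
  | H : (_ <? _) = true |- _ => apply Nat.ltb_lt in H
  | H : (_ =? _) = true |- _ => apply Nat.eqb_eq in H
  end.

Lemma corridor_odd (i p : nat) : corridor i (2 * p + 1) = false.
Proof. unfold corridor. now rewrite mod2_odd. Qed.

Lemma corridor_even (i p : nat) :
  corridor i (2 * p) = true <-> 2 * brnode p <= i <= 4 * brnode p + 2.
Proof.
  unfold corridor. rewrite mod2_even, div2_even. cbn [Nat.eqb andb].
  now rewrite andb_true_iff, !Nat.leb_le.
Qed.

Lemma corridor_even_false (i p : nat) :
  ~ (2 * brnode p <= i <= 4 * brnode p + 2) -> corridor i (2 * p) = false.
Proof. rewrite <- corridor_even. now destruct (corridor i (2 * p)). Qed.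

Lemma block_column (i p j : nat) :
  (j = 2 * p \/ j = 2 * p + 1) -> corridor i j = false -> block i j = true ->
  exists m, i = 2 * m /\ (m < brnode p \/ 2 * brnode p <= m).
Proof.
  intros Hj C B. unfold block in B. rewrite C in B.
  replace (j / 2) with p in B by (destruct Hj; subst; now rewrite ?div2_even, ?div2_odd).
  apply andb_prop in B as [_ B]. cbn [orb] in B. zify_bool.
  exists (i / 2). rewrite Nat.ltb_lt, Nat.leb_le in H0.
  pose proof (Nat.div_mod_eq i 2). split; [lia|assumption].
Qed.

(** Odd columns carry nothing but corridors, so a step to the right stays within a corridor. Under a
    corridor only the columns of the two children are open, and entering one of them replaces the
    label by a child. *)
Lemma on_branch_step (i j i' j' : nat) :
  on_branch i j -> ((i' = S i /\ j' = j) \/ (i' = i /\ j' = S j)) -> block i' j' = true ->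
  on_branch i' j' /\ (label i' j' = label i j \/ label i' j' / 2 = label i j).
Proof.
  intros (p & Hp & [(-> & m & -> & Hm)|(-> & H)]) [(-> & ->)|(-> & ->)] B;
    pose proof (level_start_spec p Hp) as HW.
  - exfalso. destruct (block_column _ p _ (or_intror eq_refl) (corridor_odd _ _) B) as (m' & E & _). lia.
  - replace (S (2 * p + 1)) with (2 * S p) in * by lia.
    pose proof (above_succ p m Hp Hm) as A.
    assert (HW' := level_start_spec (S p) ltac:(lia)).
    assert (LO : label (2 * m) (2 * p + 1) = m).
    { unfold label. now rewrite corridor_odd, div2_even. }
    rewrite LO.
    destruct (Nat.eq_dec m (brnode (S p))) as [E|E].
    + split.
      * exists (S p). split; [lia|]. right. split; [reflexivity|]. left. lia.
      * left. unfold label. rewrite (proj2 (corridor_even _ _)) by lia. now rewrite div2_even.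
    + split.
      * exists (S p). split; [lia|]. right. split; [reflexivity|]. right. eauto.
      * left. unfold label. rewrite corridor_even_false, div2_even; [reflexivity|].
        unfold above, brnode in *. lia.
  - destruct (Nat.le_gt_cases (2 * brnode p) (S i)) as [L1|L1];
      [destruct (Nat.le_gt_cases (S i) (4 * brnode p + 2)) as [L2|L2]|].
    + assert (2 * brnode p <= i <= 4 * brnode p + 2).
      { destruct H as [|(m & -> & A & Hne)]; [lia|]. unfold above, brnode in *. lia. }
      split.
      * exists p. split; [lia|]. right. split; [reflexivity|]. lia.
      * left. unfold label. now rewrite !(proj2 (corridor_even _ _)) by lia.
    + exfalso. destruct (block_column (S i) p (2 * p)) as (m' & E & H'); auto.
      { apply corridor_even_false. lia. }
      destruct H as [|(m & -> & A & Hne)]; lia.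
    + exfalso. destruct (block_column (S i) p (2 * p)) as (m' & E & H'); auto.
      { apply corridor_even_false. lia. }
      destruct H as [|(m & -> & A & Hne)]; lia.
  - replace (S (2 * p)) with (2 * p + 1) in * by lia.
    destruct (block_column _ p _ (or_intror eq_refl) (corridor_odd _ _) B) as (m' & -> & H').
    assert (LO : label (2 * m') (2 * p + 1) = m').
    { unfold label. now rewrite corridor_odd, div2_even. }
    rewrite LO. destruct H as [H|(m & E & A & Hne)].
    + assert (m' = 2 * brnode p \/ m' = 2 * brnode p + 1) by lia. split.
      * exists p. split; [lia|]. left. split; [reflexivity|]. exists m'. split; [reflexivity|].
        unfold below, brnode in *. lia.
      * right. unfold label. rewrite (proj2 (corridor_even _ _)) by lia. rewrite div2_even.
        destruct H0 as [-> | ->]; [apply div2_even|apply div2_odd].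
    + assert (m' = m) as -> by lia. split.
      * exists p. split; [lia|]. left. split; [reflexivity|]. exists m. split; [reflexivity|].
        unfold below, above, brnode in *. lia.
      * left. unfold label. rewrite corridor_even_false, div2_even; [reflexivity|].
        unfold above, brnode in *. lia.
Qed.

(** In rows [2 * p] and [2 * p + 1] the nodes in use are less than [4 * level_start p], which is at
    most [4 * p]. The bound prevents a walk from escaping sideways, so that it meets every row from
    its start on. *)
Lemma on_branch_bound (i j : nat) : on_branch i j -> i <= 4 * j.
Proof.
  intros (p & Hp & H). pose proof (level_start_spec p Hp). unfold below, above, brnode in H.
  destruct H as [(-> & m & -> & H)|(-> & [H|(m & -> & H & _)])]; lia.
Qed.

(** * Monotone walks in the thickened drawing *)

Definition inB (a b : nat) : bool := block (a / 3) (b / 3).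

Lemma comp2_inB : comp (fun z => Nat.b2n (inB (pi1 z) (pi2 z))).
Proof.
  unfold inB. pose proof comp2_block as H.
  change (comp2 (fun a b => Nat.b2n (block a b))) in H.
  apply (comp_comp2 (fun a b => Nat.b2n (block a b)) (fun z => pi1 z / 3) (fun z => pi2 z / 3) H); comp_auto.
Qed.

(** The start is the lowest square of block [(2, 2)], where the corridor of the root begins. *)
Definition walk (w : nat -> nat * nat) : Prop :=
  w 0 = (8, 8) /\
  forall t, w (S t) = (S (fst (w t)), snd (w t)) \/ w (S t) = (fst (w t), S (snd (w t))).

Lemma div3_succ (a : nat) : S a / 3 = a / 3 \/ S a / 3 = S (a / 3).
Proof.
  pose proof (Nat.div_mod_eq a 3). pose proof (Nat.mod_upper_bound a 3).
  destruct (Nat.eq_dec (a mod 3) 2).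
  - right. symmetry. apply (Nat.div_unique _ 3 _ 0); lia.
  - left. symmetry. apply (Nat.div_unique _ 3 _ (S (a mod 3))); lia.
Qed.

Section Walk.
Variable w : nat -> nat * nat.
Hypothesis Hw : walk w.
Hypothesis HB : forall t, inB (fst (w t)) (snd (w t)) = true.

Let bi t := fst (w t) / 3.
Let bj t := snd (w t) / 3.

Lemma walk_inv (t : nat) : on_branch (bi t) (bj t).
Proof.
  induction t as [|t IH].
  - unfold bi, bj. rewrite (proj1 Hw). exists 1. split; [lia|]. right. split; [reflexivity|].
    left. cbn. lia.
  - specialize (HB (S t)). destruct (proj2 Hw t) as [E|E]; unfold inB in HB; unfold bi, bj in *;
      rewrite E in *; cbn [fst snd] in *.
    + destruct (div3_succ (fst (w t))) as [D|D]; rewrite D in *; [exact IH|].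
      eapply on_branch_step; eauto.
    + destruct (div3_succ (snd (w t))) as [D|D]; rewrite D in *; [exact IH|].
      eapply on_branch_step; eauto.
Qed.

Lemma walk_label_step (t : nat) :
  label (bi (S t)) (bj (S t)) = label (bi t) (bj t) \/
  label (bi (S t)) (bj (S t)) / 2 = label (bi t) (bj t).
Proof.
  pose proof (walk_inv t) as IH.
  specialize (HB (S t)). destruct (proj2 Hw t) as [E|E]; unfold inB in HB; unfold bi, bj in *;
      rewrite E in *; cbn [fst snd] in *.
    + destruct (div3_succ (fst (w t))) as [D|D]; rewrite D in *; [auto|].
      eapply on_branch_step; eauto.
    + destruct (div3_succ (snd (w t))) as [D|D]; rewrite D in *; [auto|].
      eapply on_branch_step; eauto.
Qed.

Lemma walk_label_desc (t s : nat) : t <= s ->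
  exists d, label (bi s) (bj s) / 2 ^ d = label (bi t) (bj t).
Proof.
  induction 1 as [|s Hs (d & IH)].
  - exists 0. now rewrite Nat.pow_0_r, Nat.div_1_r.
  - destruct (walk_label_step s) as [E|E].
    + exists d. now rewrite E.
    + exists (S d). rewrite Nat.pow_succ_r', <- Nat.Div0.div_div. now rewrite E.
Qed.

Lemma walk_sum (t : nat) : fst (w t) + snd (w t) = 16 + t.
Proof.
  induction t as [|t IH]; [now rewrite (proj1 Hw)|].
  destruct (proj2 Hw t) as [E|E]; rewrite E; cbn; lia.
Qed.

Lemma walk_snd_mono (t s : nat) : t <= s -> snd (w t) <= snd (w s).
Proof.
  induction 1 as [|s Hs IH]; [lia|]. destruct (proj2 Hw s) as [E|E]; rewrite E; cbn; lia.
Qed.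

Lemma walk_snd_hits (V : nat) : 8 <= V -> exists t, snd (w t) = V.
Proof.
  intros H8.
  (* At that time the coordinates add up to [42 + 5 * V], while the first is at most four times the
     second plus 2. *)
  assert (U : V <= snd (w (26 + 5 * V))).
  { set (t := 26 + 5 * V). pose proof (walk_sum t) as S. pose proof (on_branch_bound _ _ (walk_inv t)) as I.
    unfold bi, bj in I. pose proof (Nat.div_mod_eq (fst (w t)) 3).
    pose proof (Nat.mod_upper_bound (fst (w t)) 3). pose proof (Nat.div_mod_eq (snd (w t)) 3).
    subst t. lia. }
  revert U. generalize (26 + 5 * V). intros t. induction t as [|t IH]; intros U.
  - exists 0. rewrite (proj1 Hw) in *. cbn in *. lia.
  - destruct (Nat.eq_dec (snd (w (S t))) V) as [|N]; [eauto|]. apply IH.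
    destruct (proj2 Hw t) as [E|E]; rewrite E in *; cbn in *; lia.
Qed.

(** A computable walk makes its decision at depth [e] computable: it is read off on the first
    arrival in row [V e]. At the number [e] of the machine that does so, the decision equals that
    machine's output on [e], and a node met far enough below has the time to notice, yet is
    alive. *)
Lemma walk_no_computable : ~ comp (fun t => cp (fst (w t)) (snd (w t))).
Proof.
  intros C.
  (* The first of the three rows in block row [2 * p + 1] for [p = 2 * 2 ^ e - 1], right after the
     last branching at depth [e]. There the walk is in the column of a node of depth [e + 1], whose
     parity is the decision. *)
  set (V := fun e => 12 * 2 ^ e - 3).
  assert (G : forall e, exists t, snd (w t) = V e /\ forall m, m < t -> snd (w m) <> V e).
  { intros e. assert (HV : 8 <= V e) by (unfold V; pose proof (Nat.pow_nonzero 2 e); lia).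
    destruct (dec_inh_nat_subset_has_unique_least_element (fun t => snd (w t) = V e)) as (t & (E & L) & _).
    - intros t. destruct (Nat.eq_dec (snd (w t)) (V e)); auto.
    - now apply walk_snd_hits.
    - exists t. split; [exact E|]. intros m Hm Em. specialize (L m Em). lia. }
  set (g := fun e => proj1_sig (constructive_indefinite_description _ (G e))).
  assert (Hg : forall e, snd (w (g e)) = V e /\ forall m, m < g e -> snd (w m) <> V e).
  { intros e. exact (proj2_sig (constructive_indefinite_description _ (G e))). }
  clearbody g. clear G.
  assert (Cg : comp g).
  { apply comp_mu with (fun e t => (V e - pi2 (cp (fst (w t)) (snd (w t)))) +
                                   (pi2 (cp (fst (w t)) (snd (w t))) - V e)).
    - unfold comp2, V.
      pose proof (comp_comp _ _ comp_pi2 (comp_comp _ _ C comp_pi2)) as C2. cbn beta in C2.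
      set (h := fun z => pi2 (cp (fst (w (pi2 z))) (snd (w (pi2 z))))) in *.
      change (comp (fun z => 12 * 2 ^ pi1 z - 3 - h z + (h z - (12 * 2 ^ pi1 z - 3)))).
      clearbody h. comp_arith.
    - intros e. rewrite pi2_cp, (proj1 (Hg e)). lia.
    - intros e t Ht. rewrite pi2_cp. pose proof (proj2 (Hg e) t Ht). lia. }
  set (f := fun e => (pi1 (cp (fst (w (g e))) (snd (w (g e)))) / 3 / 2) mod 2).
  assert (Cf : comp f).
  { pose proof (comp_comp _ _ comp_pi1 (comp_comp _ _ C Cg)) as C2. cbn beta in C2. unfold f.
    set (h := fun z => pi1 _) in C2.
    change (comp (fun z => (h z / 3 / 2) mod 2)). clearbody h. comp_arith. }
  destruct Cf as (c & Hc). set (e := enc c).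
  destruct (machine_complete c e (f e) (Hc _ e) 0) as (n0 & Hn0).
  change (selfrun e n0 = halt (f e)) in Hn0.
  assert (Hf : f e = (bi (g e) / 2) mod 2) by (unfold f; now rewrite pi1_cp).
  destruct (Hg e) as (E & _).
  assert (PE : 1 <= 2 ^ e) by (pose proof (Nat.pow_nonzero 2 e); lia).
  assert (Ej : bj (g e) = 2 * (2 * 2 ^ e - 1) + 1).
  { unfold bj. rewrite E. unfold V. symmetry. apply (Nat.div_unique _ 3 _ 0); lia. }
  assert (EW : level_start (2 * 2 ^ e - 1) = 2 ^ e).
  { unfold level_start. f_equal. apply Nat.log2_unique; cbn [Nat.pow]; lia. }
  destruct (walk_inv (g e)) as (p & Hp & [(Ejp & m & Ei & Hm)|(Ejp & _)]); [|lia].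
  assert (p = 2 * 2 ^ e - 1) as -> by lia.
  unfold below, brnode in Hm. rewrite EW in Hm.
  assert (Lm : label (bi (g e)) (bj (g e)) = m).
  { rewrite Ej, Ei. unfold label. now rewrite corridor_odd, div2_even. }
  rewrite Ei, div2_even in Hf.
  (* In this row [level_start] exceeds [2 ^ e + n0], so the label [m'] there allows at least [n0]
     steps. *)
  destruct (walk_snd_hits (3 * (2 * (2 * 2 ^ e + 2 * n0) + 1))) as (s & Es); [lia|].
  assert (Hs : g e <= s).
  { destruct (Nat.le_gt_cases (g e) s) as [|L]; [assumption|].
    pose proof (walk_snd_mono s (g e)). unfold V in *. lia. }
  destruct (walk_label_desc _ _ Hs) as (d & Hd). rewrite Lm in Hd.
  assert (Ejs : bj s = 2 * (2 * 2 ^ e + 2 * n0) + 1).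
  { unfold bj. rewrite Es, Nat.mul_comm. now apply Nat.div_mul. }
  destruct (walk_inv s) as (p & Hp' & [(Ejp' & m' & Ei' & Hm')|(Ejp' & _)]); [|lia].
  assert (p = 2 * 2 ^ e + 2 * n0) as -> by lia.
  pose proof (level_start_spec _ Hp') as HW. unfold below, brnode in Hm'.
  assert (Lm' : label (bi s) (bj s) = m').
  { rewrite Ejs, Ei'. unfold label. now rewrite corridor_odd, div2_even. }
  rewrite Lm' in Hd.
  assert (A : alive m' = true).
  { specialize (HB s). unfold inB, block in HB. fold (bi s) (bj s) in HB.
    apply andb_prop in HB as [HB' _]. apply andb_prop in HB' as [_ HB']. now rewrite Lm' in HB'. }
  apply (alive_spec m' d A); rewrite Hd; [lia|].
  replace (Nat.log2 m) with (S e).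
  2: { symmetry. apply Nat.log2_unique; cbn [Nat.pow]; lia. }
  replace (S e - 1) with e by lia. rewrite <- Hf.
  apply (selfrun_mono e n0); [exact Hn0|lia].
Qed.
End Walk.

(** * A noncomputable branch and a safe walk along it *)

Definition avoid (e : nat) : nat :=
  if excluded_middle_informative (exists n, selfrun e n = halt 0) then 1 else 0.

Fixpoint branch (n : nat) : nat :=
  match n with 0 => 1 | S n => 2 * branch n + avoid n end.

(** The bit 1 is opposed to the output 0, and the bit 0 to any other output and to divergence. *)
Lemma avoid_spec (e n : nat) : selfrun e n <> halt (avoid e).
Proof.
  unfold avoid. destruct (excluded_middle_informative _) as [(m & H)|H]; intros K.
  - pose proof (selfrun_unique _ _ _ _ _ H K). discriminate.
  - eauto.
Qed.

Lemma avoid_bit (e : nat) : avoid e <= 1.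
Proof. unfold avoid. destruct (excluded_middle_informative _); lia. Qed.

Lemma branch_level (n : nat) : 2 ^ n <= branch n < 2 * 2 ^ n.
Proof.
  induction n as [|n IH]; cbn [branch Nat.pow]; [lia|]. pose proof (avoid_bit n). lia.
Qed.

Lemma branch_anc (n d : nat) : d <= n -> branch n / 2 ^ d = branch (n - d).
Proof.
  revert n. induction d as [|d IH]; intros n L.
  - now rewrite Nat.pow_0_r, Nat.div_1_r, Nat.sub_0_r.
  - destruct n as [|n]; [lia|]. rewrite Nat.pow_succ_r', <- Nat.Div0.div_div.
    cbn [branch Nat.sub]. rewrite <- IH by lia. f_equal.
    symmetry. apply (Nat.div_unique _ 2 _ (avoid n)); pose proof (avoid_bit n); lia.
Qed.

Lemma branch_alive (n : nat) : alive (branch n) = true.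
Proof.
  unfold alive. apply forallb_forall. intros d _. unfold killed.
  destruct (Nat.leb_spec 2 (branch n / 2 ^ d)) as [L|L]; [|reflexivity]. cbn [andb].
  destruct (Nat.le_gt_cases d n) as [Hd|Hd].
  - rewrite branch_anc in * by assumption. pose proof (branch_level (n - d)).
    destruct (n - d) as [|e]; [cbn in L; lia|]. cbn [Nat.pow] in *.
    rewrite (Nat.log2_unique (branch (S e)) (S e)) by (cbn [Nat.pow]; lia).
    replace (S e - 1) with e by lia.
    replace (branch (S e) mod 2) with (avoid e).
    2: { apply (Nat.mod_unique _ 2 (branch e)); pose proof (avoid_bit e); cbn [branch]; lia. }
    destruct (Nat.eqb_spec (selfrun e (branch n)) (halt (avoid e))) as [E|]; [|reflexivity].
    now apply avoid_spec in E.
  - exfalso. pose proof (branch_level n).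
    pose proof (Nat.pow_le_mono_r 2 (S n) d). cbn [Nat.pow] in *.
    rewrite Nat.div_small in L; lia.
Qed.

(** A corridor counts only as far as the column of the child that [branch] chooses, which makes a
    continuation to the right or downwards always available. *)
Definition good (i j : nat) : Prop :=
  exists p n, 1 <= p /\
  ((j = 2 * p + 1 /\ i = 2 * branch n /\ below p (branch n)) \/
   (j = 2 * p /\ i = 2 * branch n /\ above p (branch n) /\ branch n <> brnode p) \/
   (j = 2 * p /\ branch n = brnode p /\ 2 * brnode p <= i <= 2 * branch (S n))).

Lemma good_block (i j : nat) : good i j -> block i j = true.
Proof.
  intros (p & n & Hp & [(-> & -> & H)|[(-> & -> & H & Hne)|(-> & E & H)]]);
    pose proof (level_start_spec p Hp); unfold block, label.
  - rewrite corridor_odd, div2_even, div2_odd, mod2_even, branch_alive.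
    rewrite (proj2 (Nat.leb_le _ _)) by lia. cbn [andb orb Nat.eqb].
    rewrite orb_true_iff, Nat.ltb_lt, Nat.leb_le. unfold below in H. lia.
  - rewrite corridor_even_false by (unfold above, brnode in *; lia).
    rewrite !div2_even, mod2_even, branch_alive.
    rewrite (proj2 (Nat.leb_le _ _)) by lia. cbn [andb orb Nat.eqb].
    rewrite orb_true_iff, Nat.ltb_lt, Nat.leb_le. unfold above in H. lia.
  - cbn [branch] in H. pose proof (avoid_bit n).
    rewrite (proj2 (corridor_even _ _)) by lia. rewrite div2_even, <- E, branch_alive.
    now rewrite (proj2 (Nat.leb_le _ _)) by lia.
Qed.

Lemma good_next (i j : nat) : good i j -> good (S i) j \/ good i (S j).
Proof.
  intros (p & n & Hp & [(-> & -> & H)|[(-> & -> & H & Hne)|(-> & E & H)]]);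
    pose proof (level_start_spec p Hp).
  - right. exists (S p), n. split; [lia|]. right. pose proof (above_succ _ _ Hp H).
    destruct (Nat.eq_dec (branch n) (brnode (S p))) as [E|E].
    + right. repeat split; [lia|assumption|lia|cbn [branch]; lia].
    + left. repeat split; [lia|assumption|assumption].
  - right. exists p, n. split; [lia|]. left. repeat split; [lia|].
    unfold above, below in *. lia.
  - destruct (Nat.eq_dec i (2 * branch (S n))) as [->|].
    + right. exists p, (S n). split; [lia|]. left. repeat split; [lia|].
      unfold below, brnode in *. pose proof (avoid_bit n). cbn [branch]. lia.
    + left. exists p, n. split; [lia|]. right. right. repeat split; [assumption|lia|lia].
Qed.

Definition next_block (c : nat * nat) : nat * nat :=
  if excluded_middle_informative (good (S (fst c)) (snd c))
  then (S (fst c), snd c) else (fst c, S (snd c)).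

Fixpoint route (n : nat) : nat * nat :=
  match n with 0 => (2, 2) | S n => next_block (route n) end.

Lemma route_good (n : nat) : good (fst (route n)) (snd (route n)).
Proof.
  induction n as [|n IH].
  - exists 1, 0. split; [lia|]. right. right. cbn. repeat split; lia.
  - cbn [route]. unfold next_block. destruct (excluded_middle_informative _) as [H|H]; [exact H|].
    cbn. destruct (good_next _ _ IH); tauto.
Qed.

(* A hole here is out of Red's reach: no red piece can step or jump into it. *)
Definition safe (h : nat * nat) : Prop :=
  exists a b, h = (S (S a), S (S b)) /\
    inB (S (S a)) (S (S b)) = true /\ inB (S a) (S (S b)) = true /\ inB a (S (S b)) = true /\
    inB (S (S a)) (S b) = true /\ inB (S (S a)) b = true.

(** The coordinate that stays fixed has remainder 2, the last one in its block, so two squares of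
    the same block precede the hole in that direction; in the moving direction the two preceding
    squares lie in the current or the next block of the route. *)
Definition fine (n r : nat) : nat * nat :=
  let c := route n in
  if excluded_middle_informative (good (S (fst c)) (snd c))
  then (3 * fst c + 2 + r, 3 * snd c + 2) else (3 * fst c + 2, 3 * snd c + 2 + r).

Lemma inB_of (i j a b r q : nat) :
  good i j -> a = 3 * i + r -> b = 3 * j + q -> r < 3 -> q < 3 -> inB a b = true.
Proof.
  intros G Ea Eb Hr Hq. unfold inB.
  rewrite <- (Nat.div_unique a 3 i r), <- (Nat.div_unique b 3 j q) by lia.
  now apply good_block.
Qed.

Ltac inB_try i j G r q := apply (inB_of i j _ _ r q G); lia.
Ltac inB_solve1 i j G :=
  first [ inB_try i j G 0 0 | inB_try i j G 0 1 | inB_try i j G 0 2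
        | inB_try i j G 1 0 | inB_try i j G 1 1 | inB_try i j G 1 2
        | inB_try i j G 2 0 | inB_try i j G 2 1 | inB_try i j G 2 2 ].
Ltac inB_solve i j G G' i' j' := first [ inB_solve1 i j G | inB_solve1 i' j' G' ].

Lemma fine_safe (n r : nat) : r < 3 -> safe (fine n r).
Proof.
  intros Hr. pose proof (route_good n) as G. pose proof (route_good (S n)) as G'.
  cbn [route] in G'. unfold next_block in G'. unfold fine.
  destruct (route n) as [i j]. cbn [fst snd] in *.
  destruct (excluded_middle_informative _); cbn [fst snd] in *.
  - exists (3 * i + r), (3 * j). split; [f_equal; lia|].
    destruct r as [|[|[|]]]; [..|lia]; repeat split; inB_solve i j G G' (S i) j.
  - exists (3 * i), (3 * j + r). split; [f_equal; lia|].
    destruct r as [|[|[|]]]; [..|lia]; repeat split; inB_solve i j G G' i (S j).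
Qed.

Definition core (t : nat) : nat * nat := fine (t / 3) (t mod 3).

Lemma core_fine (n r : nat) : r < 3 -> core (3 * n + r) = fine n r.
Proof.
  intros H. unfold core. f_equal.
  - symmetry. now apply (Nat.div_unique _ 3 _ r).
  - symmetry. now apply (Nat.mod_unique _ 3 n).
Qed.

Lemma core_safe (t : nat) : safe (core t).
Proof. apply fine_safe. now apply Nat.mod_upper_bound. Qed.

Lemma core_walk : walk core.
Proof.
  split.
  - unfold core, fine. cbn. destruct (excluded_middle_informative _); reflexivity.
  - intros t. rewrite (Nat.div_mod_eq t 3). pose proof (Nat.mod_upper_bound t 3 ltac:(lia)) as H.
    revert H. generalize (t / 3) (t mod 3). intros n r H.
    rewrite core_fine by assumption. destruct (Nat.eq_dec r 2) as [->|].
    + replace (S (3 * n + 2)) with (3 * S n + 0) by lia. rewrite core_fine by lia.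
      unfold fine. cbn [route]. unfold next_block.
      destruct (excluded_middle_informative (good (S (fst (route n))) (snd (route n))));
        cbn [fst snd]; destruct (excluded_middle_informative _); cbn [fst snd];
        ((left; f_equal; lia) || (right; f_equal; lia)).
    + replace (S (3 * n + r)) with (3 * n + S r) by lia. rewrite core_fine by lia.
      unfold fine. destruct (excluded_middle_informative _); cbn [fst snd];
        ((left; f_equal; lia) || (right; f_equal; lia)).
Qed.

(** * The position *)

Ltac Zify.zify_post_hook ::= Z.div_mod_to_equations.

(* Dark squares in diagonal coordinates: [u] grows to the south-east, [v] to the
   south-west. *)
Definition sq (u v : Z) : square := (u - v, - (u + v))%Z.

Lemma sq_inj (u v u' v' : Z) : sq u v = sq u' v' -> u = u' /\ v = v'.
Proof. unfold sq. intros [= E1 E2]. lia. Qed.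

Lemma shift_SE (u v k : Z) : shift (sq u v) SE k = sq (u + k) v.
Proof. unfold shift, sq; cbn [fst snd dvec]; f_equal; lia. Qed.
Lemma shift_SW (u v k : Z) : shift (sq u v) SW k = sq u (v + k).
Proof. unfold shift, sq; cbn [fst snd dvec]; f_equal; lia. Qed.
Lemma shift_NE (u v k : Z) : shift (sq u v) NE k = sq u (v - k).
Proof. unfold shift, sq; cbn [fst snd dvec]; f_equal; lia. Qed.
Lemma shift_NW (u v k : Z) : shift (sq u v) NW k = sq (u - k) v.
Proof. unfold shift, sq; cbn [fst snd dvec]; f_equal; lia. Qed.

Lemma sq_eqb_spec (s t : square) : reflect (s = t) (sq_eqb s t).
Proof.
  destruct s as [x y], t as [x' y']. unfold sq_eqb. cbn.
  destruct (Z.eqb_spec x x'), (Z.eqb_spec y y'); cbn; constructor; congruence.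
Qed.

Definition BP : option piece := Some (Black, Pawn).
Definition RP : option piece := Some (Red, Pawn).

(* The quadrant [u, v >= 0] carries black pawns on the corridors, except for the
   hole [h].  Outside of it everything is red, apart from infinitely many gadgets,
   in the columns [u] divisible by 3, in each of which Red can capture a black
   pawn once; [U u] tells that this has happened. *)
Definition cell (U : Z -> bool) (h : nat * nat) (u v : Z) : option piece :=
  if (0 <=? u)%Z && (0 <=? v)%Z then
    if (Z.to_nat u =? fst h) && (Z.to_nat v =? snd h) then None
    else if inB (Z.to_nat u) (Z.to_nat v) then BP else RP
  else if (0 <=? u)%Z && (u mod 3 =? 0)%Z then
    if (v =? -4)%Z then if U u then RP else None
    else if (v =? -5)%Z then if U u then None else BP
    else if (v =? -6)%Z then if U u then None else RP
    else RP
  else RP.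

Definition board_with (U : Z -> bool) (h : nat * nat) : board :=
  fun s => if Z.even (fst s + snd s)
           then cell U h ((fst s - snd s) / 2) (- (fst s + snd s) / 2) else None.

Lemma board_with_sq (U : Z -> bool) (h : nat * nat) (u v : Z) : board_with U h (sq u v) = cell U h u v.
Proof.
  unfold board_with, sq. cbn [fst snd].
  replace (u - v + - (u + v))%Z with (2 * (- v))%Z by lia. rewrite Z.even_mul. cbn [Z.even orb].
  f_equal; lia.
Qed.

Lemma dark_sq (s : square) : dark s -> exists u v, s = sq u v.
Proof.
  intros D. unfold dark in D. rewrite Z.even_spec in D. destruct D as [k Hk].
  exists ((fst s - snd s) / 2)%Z, (- k)%Z. destruct s as [x y]. cbn [fst snd] in *. unfold sq. f_equal; lia.
Qed.

Lemma board_with_dark_only (U : Z -> bool) (h : nat * nat) : dark_only (board_with U h).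
Proof.
  intros s D. unfold board_with. unfold dark in D. now destruct (Z.even (fst s + snd s)).
Qed.

Lemma board_with_piece (U : Z -> bool) (h : nat * nat) (s : square) (pc : piece) :
  board_with U h s = Some pc -> exists u v, s = sq u v.
Proof.
  intros E. apply dark_sq. destruct (classic (dark s)) as [|N]; [assumption|].
  now rewrite (board_with_dark_only U h s N) in E.
Qed.

Lemma cell_Q (U : Z -> bool) (h : nat * nat) (a b : nat) :
  cell U h (Z.of_nat a) (Z.of_nat b) =
  if (a =? fst h) && (b =? snd h) then None else if inB a b then BP else RP.
Proof.
  unfold cell. rewrite !Nat2Z.id. rewrite (proj2 (Z.leb_le 0 _)) by lia.
  now rewrite (proj2 (Z.leb_le 0 _)) by lia.
Qed.

Lemma cell_cases (U : Z -> bool) (h : nat * nat) (u v : Z) :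
  (exists a b, u = Z.of_nat a /\ v = Z.of_nat b /\
     ((h = (a, b) /\ cell U h u v = None) \/
      (h <> (a, b) /\ inB a b = true /\ cell U h u v = BP) \/
      (h <> (a, b) /\ inB a b = false /\ cell U h u v = RP))) \/
  ((u < 0 \/ v < 0)%Z /\
   (((0 <= u /\ u mod 3 = 0)%Z /\
     ((v = -4 /\ cell U h u v = if U u then RP else None) \/
      (v = -5 /\ cell U h u v = if U u then None else BP) \/
      (v = -6 /\ cell U h u v = if U u then None else RP))%Z) \/
    (~ ((0 <= u /\ u mod 3 = 0) /\ (v = -4 \/ v = -5 \/ v = -6))%Z /\ cell U h u v = RP))).
Proof.
  destruct (classic (0 <= u /\ 0 <= v)%Z) as [Q|Q].
  - left. exists (Z.to_nat u), (Z.to_nat v). split; [lia|]. split; [lia|].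
    rewrite <- (Z2Nat.id u), <- (Z2Nat.id v) by lia. rewrite cell_Q, !Nat2Z.id.
    destruct h as [a b]. cbn [fst snd].
    destruct (Nat.eqb_spec (Z.to_nat u) a), (Nat.eqb_spec (Z.to_nat v) b); cbn [andb];
      [left; split; congruence|..]; right;
      (destruct (inB (Z.to_nat u) (Z.to_nat v)); [left|right]; repeat split; congruence).
  - right. split; [lia|]. unfold cell.
    replace ((0 <=? u)%Z && (0 <=? v)%Z) with false
      by (destruct (Z.leb_spec 0 u), (Z.leb_spec 0 v); cbn; lia).
    destruct (Z.leb_spec 0 u); cbn [andb]; [|right; split; [lia|reflexivity]].
    destruct (Z.eqb_spec (u mod 3) 0); [|right; split; [lia|reflexivity]].
    destruct (Z.eqb_spec v (-4)); [left; split; [lia|auto]|].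
    destruct (Z.eqb_spec v (-5)); [left; split; [lia|auto]|].
    destruct (Z.eqb_spec v (-6)); [left; split; [lia|auto 6]|].
    right; split; [lia|reflexivity].
Qed.

Lemma cell_none (U : Z -> bool) (h : nat * nat) (u v : Z) : cell U h u v = None ->
  (u = Z.of_nat (fst h) /\ v = Z.of_nat (snd h)) \/
  ((0 <= u /\ u mod 3 = 0 /\ ((v = -4 /\ U u = false) \/ ((v = -5 \/ v = -6) /\ U u = true)))%Z).
Proof.
  intros E. destruct (cell_cases U h u v) as
    [(a & b & -> & -> & [(-> & _)|[(_ & _ & K)|(_ & _ & K)]])|
     (_ & [(Hu & [(-> & K)|[(-> & K)|(-> & K)]])|(_ & K)])];
    cbn; try (unfold BP, RP in *; congruence); auto; right; destruct (U u); unfold BP, RP in *;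
    try congruence; repeat split; try lia; auto.
Qed.

Lemma cell_black (U : Z -> bool) (h : nat * nat) (u v : Z) (k : kind) :
  cell U h u v = Some (Black, k) -> k = Pawn /\
  ((exists a b, u = Z.of_nat a /\ v = Z.of_nat b /\ h <> (a, b) /\ inB a b = true) \/
   (v = -5 /\ 0 <= u /\ u mod 3 = 0 /\ U u = false)%Z).
Proof.
  intros E. destruct (cell_cases U h u v) as
    [(a & b & -> & -> & [(-> & K)|[(N & I & K)|(_ & _ & K)]])|
     (_ & [(Hu & [(-> & K)|[(-> & K)|(-> & K)]])|(_ & K)])];
    try destruct (U u); unfold BP, RP in *; try congruence.
  - split; [congruence|]. left. exists a, b. auto.
  - split; [congruence|]. right. lia.
Qed.

Lemma cell_red (U : Z -> bool) (h : nat * nat) (u v : Z) (k : kind) :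
  cell U h u v = Some (Red, k) -> k = Pawn /\
  ((exists a b, u = Z.of_nat a /\ v = Z.of_nat b /\ h <> (a, b) /\ inB a b = false) \/
   (u < 0 \/ v < 0)%Z /\ ~ (0 <= u /\ u mod 3 = 0 /\ v = -5)%Z /\
   ~ ((0 <= u /\ u mod 3 = 0 /\ v = -4)%Z /\ U u = false) /\
   ~ ((0 <= u /\ u mod 3 = 0 /\ v = -6)%Z /\ U u = true)).
Proof.
  intros E. destruct (cell_cases U h u v) as
    [(a & b & -> & -> & [(-> & K)|[(N & I & K)|(N & I & K)]])|
     (Hq & [(Hu & [(-> & K)|[(-> & K)|(-> & K)]])|(Hn & K)])];
    try destruct (U u) eqn:EU; unfold BP, RP in *; try congruence;
    (split; [congruence|]); [left; exists a, b; auto|right..];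
    repeat split; try lia; intros [? ?]; try congruence; lia.
Qed.

Lemma cell_hole_indep (U : Z -> bool) (h h' : nat * nat) (u v : Z) :
  ~ (u = Z.of_nat (fst h) /\ v = Z.of_nat (snd h)) ->
  ~ (u = Z.of_nat (fst h') /\ v = Z.of_nat (snd h')) -> cell U h u v = cell U h' u v.
Proof.
  intros N N'. unfold cell.
  destruct (Z.leb_spec 0 u), (Z.leb_spec 0 v); cbn [andb]; try reflexivity.
  replace ((Z.to_nat u =? fst h) && (Z.to_nat v =? snd h)) with false;
  [replace ((Z.to_nat u =? fst h') && (Z.to_nat v =? snd h')) with false; [reflexivity|]|].
  - destruct (Nat.eqb_spec (Z.to_nat u) (fst h')), (Nat.eqb_spec (Z.to_nat v) (snd h')); cbn; lia.
  - destruct (Nat.eqb_spec (Z.to_nat u) (fst h)), (Nat.eqb_spec (Z.to_nat v) (snd h)); cbn; lia.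
Qed.

Definition sqn (h : nat * nat) : square := sq (Z.of_nat (fst h)) (Z.of_nat (snd h)).

Lemma board_with_hole_indep (U : Z -> bool) (h h' : nat * nat) (t : square) :
  t <> sqn h -> t <> sqn h' -> board_with U h t = board_with U h' t.
Proof.
  intros N N'. destruct (classic (dark t)) as [D|D].
  - destruct (dark_sq t D) as (u & v & ->). rewrite !board_with_sq. apply cell_hole_indep.
    + intros [-> ->]. now apply N.
    + intros [-> ->]. now apply N'.
  - now rewrite !board_with_dark_only.
Qed.

Lemma board_with_hole (U : Z -> bool) (h : nat * nat) : board_with U h (sqn h) = None.
Proof. unfold sqn. now rewrite board_with_sq, cell_Q, !Nat.eqb_refl. Qed.

Lemma board_with_inB (U : Z -> bool) (h h' : nat * nat) :
  h' <> h -> inB (fst h') (snd h') = true -> board_with U h (sqn h') = BP.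
Proof.
  intros N I. unfold sqn. rewrite board_with_sq, cell_Q, I. destruct h, h'. cbn [fst snd] in *.
  destruct (Nat.eqb_spec n1 n), (Nat.eqb_spec n2 n0); cbn; congruence.
Qed.

Definition succ_of (h h' : nat * nat) : Prop :=
  h' = (S (fst h), snd h) \/ h' = (fst h, S (snd h)).

Lemma succ_of_neq (h h' : nat * nat) : succ_of h h' -> h' <> h.
Proof. destruct h as [a b]. intros [-> | ->] [= E]; lia. Qed.

Lemma sqn_inj (h h' : nat * nat) : sqn h = sqn h' -> h = h'.
Proof.
  destruct h, h'. unfold sqn. intros E. apply sq_inj in E. cbn in E. f_equal; lia.
Qed.

Lemma upd_hole (b : board) (U : Z -> bool) (h h' : nat * nat) (t : square) :
  h' <> h -> inB (fst h) (snd h) = true -> b t = board_with U h t ->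
  upd (upd b (sqn h') None) (sqn h) BP t = board_with U h' t.
Proof.
  intros N I E. unfold upd.
  destruct (sq_eqb_spec t (sqn h)) as [->|N1]; [now rewrite board_with_inB by auto|].
  destruct (sq_eqb_spec t (sqn h')) as [->|N2]; [now rewrite board_with_hole|].
  rewrite E. now apply board_with_hole_indep.
Qed.

(** The first square outside starts a new block, which is three squares wide and so contains the
    next square as well. *)
Lemma inB_gap_l (a b : nat) : inB a b = true -> inB (S a) b = false -> inB (S (S a)) b = false.
Proof.
  unfold inB. intros H1 H2. destruct (div3_succ a) as [E|E]; [congruence|].
  replace (S (S a) / 3) with (S a / 3); [assumption|].
  pose proof (Nat.div_mod_eq a 3). pose proof (Nat.mod_upper_bound a 3).
  pose proof (Nat.div_mod_eq (S a) 3). pose proof (Nat.mod_upper_bound (S a) 3).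
  pose proof (Nat.div_mod_eq (S (S a)) 3). pose proof (Nat.mod_upper_bound (S (S a)) 3). lia.
Qed.

Lemma inB_gap_r (a b : nat) : inB a b = true -> inB a (S b) = false -> inB a (S (S b)) = false.
Proof.
  unfold inB. intros H1 H2. destruct (div3_succ b) as [E|E]; [congruence|].
  replace (S (S b) / 3) with (S b / 3); [assumption|].
  pose proof (Nat.div_mod_eq b 3). pose proof (Nat.mod_upper_bound b 3).
  pose proof (Nat.div_mod_eq (S b) 3). pose proof (Nat.mod_upper_bound (S b) 3).
  pose proof (Nat.div_mod_eq (S (S b)) 3). pose proof (Nat.mod_upper_bound (S (S b)) 3). lia.
Qed.

Definition bdir (h h' : nat * nat) : dir := if fst h' =? fst h then NE else NW.

Lemma succ_shift (h h' : nat * nat) : succ_of h h' -> shift (sqn h') (bdir h h') 1 = sqn h.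
Proof.
  unfold bdir, sqn. intros [-> | ->]; cbn [fst snd].
  - replace (S (fst h) =? fst h) with false by (symmetry; apply Nat.eqb_neq; lia).
    rewrite shift_NW. f_equal. lia.
  - rewrite Nat.eqb_refl, shift_NE. f_equal. lia.
Qed.

Lemma bdir_allowed (h h' : nat * nat) : allowed (Black, Pawn) (bdir h h').
Proof. unfold bdir. destruct (_ =? _); cbn; auto. Qed.

(** Beside the hole, no black pawn stands behind a red one, by [inB_gap_l] and [inB_gap_r]. A jump
    out of the quadrant would land at a coordinate -1 or -2, where all is red; hence the gadgets
    begin at -4. The pawn of a gadget would land in its own column at -7 or two columns away, and
    both squares are red because gadgets are three columns apart. *)
Lemma no_black_jump (U : Z -> bool) (h : nat * nat) (s : square) (k : kind) (d : dir) :
  inB (fst h) (snd h) = true -> board_with U h s = Some (Black, k) ->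
  ~ jump_ok (board_with U h) s (Black, k) d.
Proof.
  intros I Es (A & ((c & k') & Em & Ec) & Et). cbn in Ec.
  assert (c = Red) as -> by (destruct c; congruence).
  destruct (board_with_piece _ _ _ _ Es) as (u & v & ->).
  rewrite board_with_sq in Es. apply cell_black in Es as (-> & Es). cbn in A.
  destruct A as [-> | ->]; rewrite ?shift_NE, ?shift_NW, ?board_with_sq in *;
    apply cell_red in Em as (_ & Em); apply cell_none in Et;
    destruct Es as [(a & b & -> & -> & Hh & Hab)|Es].
  - destruct Et as [(Eu & Ev)|Et]; [|lia].
    destruct Em as [(a' & b' & Ea & Eb & _ & Hm)|Em]; [|lia].
    assert (a = fst h) by lia. assert (b = S (S (snd h))) by lia.
    assert (a' = fst h) by lia. assert (b' = S (snd h)) by lia. subst.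
    now rewrite (inB_gap_r _ _ I Hm) in Hab.
  - lia.
  - destruct Et as [(Eu & Ev)|Et]; [|lia].
    destruct Em as [(a' & b' & Ea & Eb & _ & Hm)|Em]; [|lia].
    assert (b = snd h) by lia. assert (a = S (S (fst h))) by lia.
    assert (b' = snd h) by lia. assert (a' = S (fst h)) by lia. subst.
    now rewrite (inB_gap_l _ _ I Hm) in Hab.
  - lia.
Qed.

Lemma no_black_jump_available (U : Z -> bool) (h : nat * nat) (p : position) :
  inB (fst h) (snd h) = true -> (forall t, pboard p t = board_with U h t) -> pturn p = Black ->
  ~ jump_available p.
Proof.
  intros I Hp T (s & (c & k) & d & Es & Ec & A & (pc' & Em & Ec') & Et). rewrite Hp in *.
  rewrite T in Ec. cbn in Ec. subst c.
  apply (no_black_jump U h s k d I Es). repeat split; eauto.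
Qed.

Lemma black_legal (v : variant) (U : Z -> bool) (h : nat * nat) (p p' : position) (m : move) :
  inB (fst h) (snd h) = true -> (forall t, pboard p t = board_with U h t) -> pturn p = Black ->
  legal v p m p' ->
  exists h', succ_of h h' /\ inB (fst h') (snd h') = true /\ mfrom m = sqn h' /\
    mjump m = false /\ mpath m 0 = Some (bdir h h') /\ (forall k, mpath m (S k) = None) /\
    pturn p' = Red /\ (forall t, pboard p' t = board_with U h' t).
Proof.
  intros I Hp T ((c & k) & Es & Ec & T' & L). rewrite T in *. cbn in Ec, T'. subst c.
  rewrite Hp in Es.
  destruct L as [(Hj & (d & H0 & HS & A & Et & HB) & _)|(Hj & H0 & _ & J & _)].
  - destruct (board_with_piece _ _ _ _ Es) as (x & y & Ef). rewrite Ef in *. rewrite Hp in Et.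
    rewrite board_with_sq in Es. apply cell_black in Es as (-> & Es). cbn in A.
    assert (R : exists h', succ_of h h' /\ inB (fst h') (snd h') = true /\
                  sq x y = sqn h' /\ d = bdir h h').
    { destruct A as [-> | ->]; rewrite ?shift_NE, ?shift_NW, ?board_with_sq in Et;
        apply cell_none in Et; destruct Es as [(a & b & -> & -> & Hh & Hab)|Es].
      - destruct Et as [(Eu & Ev)|Et]; [|lia].
        exists (a, b). assert (a = fst h) by lia. assert (b = S (snd h)) by lia. subst a b.
        repeat split; [now right|assumption|]. unfold bdir. cbn. now rewrite Nat.eqb_refl.
      - destruct Et as [Et|(_ & _ & [Et|([Et|Et] & EU)])]; [lia..|].
        destruct Es as (_ & _ & _ & Es). congruence.
      - destruct Et as [(Eu & Ev)|Et]; [|lia].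
        exists (a, b). assert (b = snd h) by lia. assert (a = S (fst h)) by lia. subst a b.
        repeat split; [now left|assumption|]. unfold bdir. cbn [fst].
        now rewrite (proj2 (Nat.eqb_neq _ _)) by lia.
      - lia. }
    destruct R as (h' & S & I' & E & ->). exists h'. rewrite E in *.
    repeat split; auto. intros t. rewrite HB, succ_shift by assumption.
    apply upd_hole; auto using succ_of_neq.
  - exfalso. destruct (mpath m 0) as [d|] eqn:E0; [|congruence].
    destruct (J 0 d E0) as (A & (pc' & Em & Ec') & Et). cbn [jstate fst snd] in *.
    rewrite Hp in *. apply (no_black_jump U h (mfrom m) k d I Es). repeat split; eauto.
Qed.

Definition bmove (h h' : nat * nat) : move :=
  mkMove (sqn h') false (fun k => match k with 0 => Some (bdir h h') | S _ => None end).

Lemma bmove_legal (v : variant) (h h' : nat * nat) (p : position) :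
  succ_of h h' -> pturn p = Black -> pboard p (sqn h') = BP -> pboard p (sqn h) = None ->
  (forced_jump v -> ~ jump_available p) ->
  exists p', legal v p (bmove h h') p'.
Proof.
  intros S T E E' NJ.
  exists (mkPosition (upd (upd (pboard p) (sqn h') None) (sqn h) BP) Red).
  exists (Black, Pawn). cbn [mfrom mjump mpath bmove pturn pboard].
  repeat split; auto; [now rewrite T|]. left. repeat split; auto.
  exists (bdir h h'). rewrite succ_shift by assumption. repeat split; auto using bdir_allowed.
Qed.

(** * Red's moves *)

Definition use (U : Z -> bool) (c : Z) : Z -> bool := fun x => if (x =? c)%Z then true else U x.

Definition gadget (c : Z) : Prop := (0 <= c /\ c mod 3 = 0)%Z.

Lemma cell_gadget (U : Z -> bool) (h : nat * nat) (c : Z) : gadget c ->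
  cell U h c (-4) = (if U c then RP else None) /\
  cell U h c (-5) = (if U c then None else BP) /\
  cell U h c (-6) = (if U c then None else RP).
Proof.
  intros [H1 H2]. unfold cell. rewrite (proj2 (Z.leb_le 0 c)), (proj2 (Z.eqb_eq _ _) H2) by lia.
  cbn. auto.
Qed.

Lemma cell_use (U : Z -> bool) (h : nat * nat) (c u v : Z) :
  u <> c \/ (v <> -4 /\ v <> -5 /\ v <> -6)%Z -> cell (use U c) h u v = cell U h u v.
Proof.
  intros H. unfold cell, use.
  destruct ((0 <=? u)%Z && (0 <=? v)%Z); [reflexivity|].
  destruct ((0 <=? u)%Z && (u mod 3 =? 0)%Z); [|reflexivity].
  destruct (Z.eqb_spec v (-4)), (Z.eqb_spec v (-5)), (Z.eqb_spec v (-6)), (Z.eqb_spec u c);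
    try reflexivity; lia.
Qed.

Lemma gadget_jump (U : Z -> bool) (h : nat * nat) (c : Z) (b : board) (t : square) :
  gadget c -> U c = false -> (forall t, b t = board_with U h t) ->
  do_jump b (sq c (-6)) (Red, Pawn) SW t = board_with (use U c) h t.
Proof.
  intros G HU Hb. unfold do_jump. rewrite !shift_SW. unfold upd.
  change (-6 + 2)%Z with (-4)%Z. change (-6 + 1)%Z with (-5)%Z.
  destruct (cell_gadget (use U c) h c G) as (E4 & E5 & E6).
  replace (use U c c) with true in * by (unfold use; now rewrite Z.eqb_refl).
  destruct (sq_eqb_spec t (sq c (-4))) as [->|N4]; [rewrite board_with_sq, E4; reflexivity|].
  destruct (sq_eqb_spec t (sq c (-5))) as [->|N5]; [rewrite board_with_sq, E5; reflexivity|].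
  destruct (sq_eqb_spec t (sq c (-6))) as [->|N6]; [rewrite board_with_sq, E6; reflexivity|].
  rewrite Hb. destruct (classic (dark t)) as [D|D]; [|now rewrite !board_with_dark_only].
  destruct (dark_sq t D) as (u & v & ->). rewrite !board_with_sq. symmetry. apply cell_use.
  destruct (Z.eq_dec u c) as [->|]; [right|now left].
  repeat split; intros ->; congruence.
Qed.

Definition rmove (c : Z) : move :=
  mkMove (sq c (-6)) true (fun k => match k with 0 => Some SW | S _ => None end).

Lemma gadget_jump_ok (U : Z -> bool) (h : nat * nat) (c : Z) :
  gadget c -> U c = false -> jump_ok (board_with U h) (sq c (-6)) (Red, Pawn) SW.
Proof.
  intros G HU. destruct (cell_gadget U h c G) as (E4 & E5 & E6). rewrite HU in *.
  repeat split; [now right| |].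
  - exists (Black, Pawn). rewrite shift_SW, board_with_sq. split; [exact E5|discriminate].
  - rewrite shift_SW, board_with_sq. exact E4.
Qed.

Lemma jump_ok_ext (b b' : board) (s : square) (pc : piece) (d : dir) :
  (forall t, b t = b' t) -> jump_ok b s pc d -> jump_ok b' s pc d.
Proof. intros E (A & M & T). unfold jump_ok. rewrite <- !E. auto. Qed.

(** Both squares ahead of the landing square are red, so a capture ends the turn under every
    rule. *)
Lemma no_second_jump (U : Z -> bool) (h : nat * nat) (c : Z) (d : dir) :
  gadget c -> ~ jump_ok (board_with U h) (sq c (-4)) (Red, Pawn) d.
Proof.
  intros [G1 G2] (A & ((c' & k) & Em & Ec) & _). cbn in A, Ec.
  assert (c' = Black) as -> by (destruct c'; congruence).
  destruct A as [-> | ->]; rewrite ?shift_SE, ?shift_SW, board_with_sq in Em;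
    apply cell_black in Em as (_ & [(a & b & E1 & E2 & _)|E]); lia.
Qed.

Lemma rmove_legal (v : variant) (U : Z -> bool) (h : nat * nat) (c : Z) (p p' : position) :
  gadget c -> U c = false -> (forall t, pboard p t = board_with U h t) -> pturn p = Red ->
  (forall t, pboard p' t = board_with (use U c) h t) -> pturn p' = Black ->
  legal v p (rmove c) p'.
Proof.
  intros G HU Hp T Hp' T'. exists (Red, Pawn). cbn [mfrom mjump mpath rmove].
  destruct (cell_gadget U h c G) as (E4 & E5 & E6). rewrite HU in *.
  assert (J : forall t, fst (jstate (pboard p) (sq c (-6)) (Red, Pawn)
      (fun k => match k with 0 => Some SW | S _ => None end) 1) t = board_with (use U c) h t).
  { intros t. cbn [jstate fst snd]. now apply gadget_jump. }
  rewrite T, Hp, board_with_sq, T'. repeat split; auto. right.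
  split; [reflexivity|]. split; [discriminate|]. split; [now intros [|i]|]. split.
  - intros [|k] d [= <-]. cbn [jstate fst snd]. apply (jump_ok_ext (board_with U h)); [|now apply gadget_jump_ok].
    intros t. symmetry. apply Hp.
  - left. exists 1. repeat split.
    + intros t. now rewrite J.
    + intros _ d K. apply (jump_ok_ext _ _ _ _ _ J) in K. cbn [jstate snd] in K.
      rewrite shift_SW in K. exact (no_second_jump _ _ _ _ G K).
Qed.

(** The four squares from which a red pawn could step ([j = 1]) or jump ([j = 2]) into the hole are
    those that [safe] puts into the black region. *)
Lemma safe_black (U : Z -> bool) (h : nat * nat) (u v : Z) (k : kind) (d : dir) (j : Z) :
  safe h -> (j = 1 \/ j = 2)%Z -> allowed (Red, Pawn) d ->
  shift (sq u v) d j = sqn h -> cell U h u v <> Some (Red, k).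
Proof.
  intros (a & b & -> & I0 & I1 & I2 & I3 & I4) Hj A E K.
  apply cell_red in K as (_ & [(a' & b' & -> & -> & _ & Hn)|K]); unfold sqn in E; cbn [fst snd] in E;
    destruct A as [-> | ->]; rewrite ?shift_SE, ?shift_SW in E; apply sq_inj in E;
    destruct Hj as [-> | ->]; try lia.
  - assert (a' = S a) by lia. assert (b' = S (S b)) by lia. congruence.
  - assert (a' = a) by lia. assert (b' = S (S b)) by lia. congruence.
  - assert (a' = S (S a)) by lia. assert (b' = S b) by lia. congruence.
  - assert (a' = S (S a)) by lia. assert (b' = b) by lia. congruence.
Qed.

Lemma red_jump_gadget (U : Z -> bool) (h : nat * nat) (s : square) (k : kind) (d : dir) :
  safe h -> board_with U h s = Some (Red, k) -> jump_ok (board_with U h) s (Red, k) d ->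
  k = Pawn /\ exists c, gadget c /\ U c = false /\ s = sq c (-6) /\ d = SW.
Proof.
  intros Sh Es (A & ((c & k') & Em & Ec) & Et). cbn in Ec.
  assert (c = Black) as -> by (destruct c; congruence).
  destruct (board_with_piece _ _ _ _ Es) as (u & v & ->). rewrite board_with_sq in Es.
  pose proof (cell_red _ _ _ _ _ Es) as (-> & Hs). split; [reflexivity|].
  assert (Nh : shift (sq u v) d 2 <> sqn h).
  { intros E. eapply safe_black; eauto. }
  cbn in A. destruct A as [-> | ->]; rewrite ?shift_SE, ?shift_SW in *; rewrite board_with_sq in *;
    apply cell_none in Et as [(E1 & E2)|Et]; try (exfalso; apply Nh; unfold sqn; congruence);
    apply cell_black in Em as (_ & [(a & b & E1 & E2 & _)|Em]); try lia.
  destruct Em as (E1 & E2 & E3 & E4). assert (v = -6)%Z as -> by lia.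
  exists u. repeat split; auto.
Qed.

Lemma red_legal_forced (v : variant) (U : Z -> bool) (h : nat * nat) (p p' : position) (m : move) :
  forced_jump v -> (exists c, gadget c /\ U c = false) ->
  safe h -> (forall t, pboard p t = board_with U h t) -> pturn p = Red ->
  legal v p m p' ->
  exists c, gadget c /\ pturn p' = Black /\ (forall t, pboard p' t = board_with (use U c) h t).
Proof.
  intros F (c0 & G0 & HU0) Sh Hp T ((c & k) & Es & Ec & T' & L). rewrite T in *. cbn in Ec, T'. subst c.
  destruct L as [(_ & _ & NJ)|(_ & H0 & Hstop & J & End)].
  - exfalso. apply (NJ F). exists (sq c0 (-6)), (Red, Pawn), SW.
    destruct (cell_gadget U h c0 G0) as (_ & _ & E6). rewrite HU0 in E6.
    rewrite Hp, board_with_sq, T. repeat split; auto; [now right|..].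
    + destruct (gadget_jump_ok U h c0 G0 HU0) as (_ & (pc & E & N) & _).
      exists pc. now rewrite Hp.
    + rewrite Hp. now apply gadget_jump_ok.
  - destruct (mpath m 0) as [d|] eqn:E0; [|congruence].
    pose proof (J 0 d E0) as J0. cbn [jstate fst snd] in J0.
    apply (jump_ok_ext _ _ _ _ _ Hp) in J0. rewrite Hp in Es.
    destruct (red_jump_gadget U h _ k d Sh Es J0) as (-> & c & G & HU & Ef & ->).
    exists c. repeat split; auto; try apply G.
    assert (J1 : forall t, fst (jstate (pboard p) (mfrom m) (Red, Pawn) (mpath m) 1) t =
                           board_with (use U c) h t).
    { intros t. cbn [jstate]. rewrite E0. cbn [fst snd]. rewrite Ef. now apply gadget_jump. }
    assert (P1 : mpath m 1 = None).
    { destruct (mpath m 1) as [d|] eqn:E1; [|reflexivity]. exfalso.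
      pose proof (J 1 d E1) as K. apply (jump_ok_ext _ _ _ _ _ J1) in K.
      cbn [jstate] in K. rewrite E0 in K. cbn [snd] in K. rewrite Ef, shift_SW in K.
      exact (no_second_jump _ _ _ _ G K). }
    destruct End as [(n & En & HB & _)|(Hinf & _)]; [|now apply Hinf in P1].
    destruct n as [|n]; [congruence|].
    assert (PS : forall i, mpath m (S i) = None) by (induction i; auto).
    intros t. rewrite HB, <- J1.
    enough (jstate (pboard p) (mfrom m) (Red, Pawn) (mpath m) (S n) =
            jstate (pboard p) (mfrom m) (Red, Pawn) (mpath m) 1) as -> by reflexivity.
    clear En HB. induction n as [|n IH]; [reflexivity|]. rewrite <- IH. cbn [jstate].
    now rewrite (PS n).
Qed.

(* Without forced jumps Red may do anything outside the quadrant; all that is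
   needed is that the quadrant is untouched. *)
Definition agree (b : board) (h : nat * nat) : Prop :=
  (forall x y : nat, b (sqn (x, y)) = board_with (fun _ => false) h (sqn (x, y))) /\
  (forall s c k, b s = Some (c, k) -> k = Pawn).

Lemma agree_upd (b : board) (h : nat * nat) (s : square) (o : option piece) :
  agree b h -> (forall x y, s <> sqn (x, y)) -> (forall c k, o = Some (c, k) -> k = Pawn) ->
  agree (upd b s o) h.
Proof.
  intros [H1 H2] N K. split.
  - intros x y. unfold upd. destruct (sq_eqb_spec (sqn (x, y)) s) as [E|_]; [|apply H1].
    now destruct (N x y).
  - intros t c k. unfold upd. destruct (sq_eqb_spec t s) as [_|_]; eauto.
Qed.

(** A red pawn only ever increases [u] or [v], so it cannot leave the quadrant once inside. *)
Lemma outside_back (s : square) (d : dir) (j : Z) :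
  (0 <= j)%Z -> allowed (Red, Pawn) d -> (forall x y, shift s d j <> sqn (x, y)) ->
  forall x y, s <> sqn (x, y).
Proof.
  intros Hj A N x y ->. unfold sqn in *. cbn [fst snd] in *. destruct A as [-> | ->].
  - apply (N (x + Z.to_nat j) y). rewrite shift_SE. f_equal. lia.
  - apply (N x (y + Z.to_nat j)). rewrite shift_SW. f_equal. lia.
Qed.

(** The hole is the only empty square of the quadrant. Being safe, it has coordinates at least 2, so
    a piece landing there also starts in the quadrant, which [safe_black] excludes. *)
Lemma landing_outside (b : board) (h : nat * nat) (s : square) (d : dir) (j : Z) (k : kind) :
  safe h -> agree b h -> (j = 1 \/ j = 2)%Z -> allowed (Red, Pawn) d ->
  b s = Some (Red, k) -> b (shift s d j) = None -> forall x y, shift s d j <> sqn (x, y).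
Proof.
  intros Sh [H1 _] Hj A Es Et x y E. rewrite E, H1 in Et. unfold sqn in Et.
  rewrite board_with_sq in Et. cbn [fst snd] in Et.
  apply cell_none in Et as [(Ex & Ey)|Et]; [|lia].
  assert (Eh : (x, y) = h) by (destruct h; cbn [fst snd] in *; f_equal; lia).
  rewrite Eh in E. pose proof Sh as (a & b' & Eab & _).
  assert (exists a' b'', s = sqn (a', b'')) as (a' & b'' & ->).
  { subst h. unfold sqn, shift, sq in E. cbn [fst snd] in E. destruct s as [sx sy].
    destruct A as [-> | ->]; cbn [fst snd dvec] in E; pose proof (f_equal fst E) as E1;
      pose proof (f_equal snd E) as E2; cbn [fst snd] in E1, E2; injection Eab as -> ->.
    - exists (Z.to_nat (Z.of_nat (S (S a)) - j)), (S (S b')). unfold sqn, sq. cbn [fst snd]. f_equal; lia.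
    - exists (S (S a)), (Z.to_nat (Z.of_nat (S (S b')) - j)). unfold sqn, sq. cbn [fst snd]. f_equal; lia. }
  rewrite H1 in Es. unfold sqn at 1 in Es. rewrite board_with_sq in Es.
  eapply safe_black in Es; eauto.
Qed.

Lemma red_jump_agree (b : board) (h : nat * nat) (s : square) (k : kind) (d : dir) :
  safe h -> agree b h -> b s = Some (Red, k) -> jump_ok b s (Red, k) d ->
  agree (do_jump b s (Red, k) d) h /\
  (forall x y, s <> sqn (x, y)) /\ (forall x y, shift s d 1 <> sqn (x, y)) /\
  do_jump b s (Red, k) d (shift s d 2) = Some (Red, k).
Proof.
  intros Sh Ag Es (A & _ & Et).
  assert (k = Pawn) as -> by (eapply (proj2 Ag); eauto).
  assert (N2 := landing_outside b h s d 2 Pawn Sh Ag (or_intror eq_refl) A Es Et).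
  assert (N0 := outside_back s d 2 ltac:(lia) A N2).
  assert (N1 : forall x y, shift s d 1 <> sqn (x, y)).
  { apply (outside_back (shift s d 1) d 1); [lia|assumption|]. intros x y E. apply (N2 x y).
    rewrite <- E. unfold shift. cbn [fst snd]. f_equal; lia. }
  unfold do_jump. split; [|split; [exact N0|split; [exact N1|]]].
  - apply agree_upd; [apply agree_upd; [apply agree_upd|..]|..]; auto; congruence.
  - unfold upd. now destruct (sq_eqb_spec (shift s d 2) (shift s d 2)).
Qed.

Lemma red_legal_agree (v : variant) (h : nat * nat) (p p' : position) (m : move) :
  safe h -> agree (pboard p) h -> pturn p = Red -> legal v p m p' ->
  pturn p' = Black /\ agree (pboard p') h.
Proof.
  intros Sh Ag T ((c & k) & Es & Ec & T' & L). rewrite T in *. cbn in Ec, T'. subst c.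
  split; [assumption|].
  destruct L as [(_ & (d & _ & _ & A & Et & HB) & _)|(_ & H0 & _ & J & End)].
  - assert (k = Pawn) as -> by (eapply (proj2 Ag); eauto).
    assert (N1 := landing_outside _ h _ d 1 Pawn Sh Ag (or_introl eq_refl) A Es Et).
    assert (N0 := outside_back _ d 1 ltac:(lia) A N1).
    assert (Ag' : agree (upd (upd (pboard p) (mfrom m) None) (shift (mfrom m) d 1)
                    (Some (Red, Pawn))) h).
    { apply agree_upd; [apply agree_upd|..]; auto; congruence. }
    split.
    + intros x y. rewrite HB. apply Ag'.
    + intros s c k. rewrite HB. apply Ag'.
  - set (st := jstate (pboard p) (mfrom m) (Red, k) (mpath m)) in *.
    assert (K : forall n, agree (fst (st n)) h /\ fst (st n) (snd (st n)) = Some (Red, k)).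
    { induction n as [|n [IH1 IH2]]; [now split|].
      subst st. cbn [jstate]. set (st := jstate (pboard p) (mfrom m) (Red, k) (mpath m)) in *.
      destruct (mpath m n) as [d|] eqn:E; [|now split]. cbn [fst snd].
      pose proof (red_jump_agree _ h _ k d Sh IH1 IH2 (J n d E)). tauto. }
    destruct End as [(n & _ & HB & _)|(_ & HB)].
    + split.
      * intros x y. rewrite HB. apply K.
      * intros s c k'. rewrite HB. apply K.
    (* An infinite iterated jump has no final board, only a set of removed squares; none of them
       lies in the quadrant. *)
    + assert (M : forall t, ~ (exists x y, t = sqn (x, y)) \/
         ~ (t = mfrom m \/ exists k0 d, mpath m k0 = Some d /\ t = shift (snd (st k0)) d 1)).
      { intros t. destruct (classic (exists x y, t = sqn (x, y))) as [(x & y & ->)|N]; [right|now left].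
        destruct (mpath m 0) as [d0|] eqn:E0; [|congruence].
        intros [E|(n & d & E & E1)].
        - pose proof (red_jump_agree _ h _ k d0 Sh (proj1 (K 0)) (proj2 (K 0)) (J 0 d0 E0)) as R.
          now apply (proj1 (proj2 R) x y).
        - pose proof (red_jump_agree _ h _ k d Sh (proj1 (K n)) (proj2 (K n)) (J n d E)) as R.
          now apply (proj1 (proj2 (proj2 R)) x y). }
      split.
      * intros x y. destruct (M (sqn (x, y))) as [N|N]; [exfalso; eauto|].
        rewrite (proj2 (HB _) N). apply Ag.
      * intros s c k' E.
        destruct (classic (s = mfrom m \/ exists k0 d, mpath m k0 = Some d /\
                                             s = shift (snd (st k0)) d 1)) as [Y|N].
        -- rewrite (proj1 (HB _) Y) in E. discriminate.
        -- rewrite (proj2 (HB _) N) in E. eapply (proj2 Ag); eauto.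
Qed.

(** * Plays *)

(** Indexing by the length of the history makes every capture fresh. The offset 3 keeps the vertical
    coordinate of the capturing pawn negative, so that [enc_Z] is given by one formula. *)
Definition gcol (l : nat) : Z := Z.of_nat (3 * (l + 3)).
Definition red_strategy : strategy := fun h => rmove (gcol (length h)).
Definition core_strategy : strategy :=
  fun h => bmove (core (length h / 2)) (core (S (length h / 2))).
Definition start : position := mkPosition (board_with (fun _ => false) (8, 8)) Black.

Lemma gcol_gadget (l : nat) : gadget (gcol l).
Proof. unfold gadget, gcol. lia. Qed.

Lemma hist_length (sB sR : strategy) (t0 : color) (n : nat) : length (hist sB sR t0 n) = n.
Proof. induction n as [|n IH]; cbn; [reflexivity|]. rewrite length_app, IH. cbn. lia. Qed.

Lemma turn_at_even (t : nat) : turn_at Black (2 * t) = Black.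
Proof. unfold turn_at. now rewrite Nat.even_mul. Qed.
Lemma turn_at_odd (t : nat) : turn_at Black (2 * t + 1) = Red.
Proof. unfold turn_at. now rewrite Nat.add_1_r, Nat.even_succ, Nat.odd_mul. Qed.

Lemma turn_at_succ (c : color) (k : nat) : turn_at c (S k) = opp (turn_at c k).
Proof.
  unfold turn_at. rewrite Nat.even_succ, <- Nat.negb_even. now destruct (Nat.even k), c.
Qed.

Lemma legal_turn (v : variant) (p p' : position) (m : move) :
  legal v p m p' -> pturn p' = opp (pturn p).
Proof. intros (pc & _ & _ & T & _). exact T. Qed.

(** Boards are functions, and [legal] fixes the resulting one only pointwise; this allows it to be
    replaced by a canonical board. *)
Lemma legal_ext (v : variant) (p p' p'' : position) (m : move) :
  legal v p m p' -> pturn p'' = pturn p' -> (forall t, pboard p'' t = pboard p' t) ->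
  legal v p m p''.
Proof.
  intros (pc & E & C & T & L) T' H. exists pc. rewrite T'.
  split; [assumption|]. split; [assumption|]. split; [assumption|].
  destruct L as [(J & (d & H0 & HS & A & Et & HB) & F)|(J & H0 & HS & Hj & [(n & En & HB & F)|(I & HB)])].
  - left. repeat split; auto. exists d. repeat split; auto. intros t. now rewrite H.
  - right. split; [assumption|]. split; [assumption|]. split; [assumption|]. split; [assumption|].
    left. exists n. split; [assumption|]. split; [|assumption]. intros t. now rewrite H.
  - right. split; [assumption|]. split; [assumption|]. split; [assumption|]. split; [assumption|].
    right. split; [assumption|]. intros t. rewrite H. apply HB.
Qed.

Fixpoint used (k : nat) : Z -> bool :=
  match k with
  | 0 => fun _ => false
  | S k => if Nat.even k then used k else use (used k) (gcol k)
  end.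

Lemma used_fresh (k l : nat) : k <= l -> used k (gcol l) = false.
Proof.
  induction k as [|k IH]; intros L; [reflexivity|]. cbn [used].
  destruct (Nat.even k); [apply IH; lia|]. unfold use. rewrite IH by lia.
  now rewrite (proj2 (Z.eqb_neq _ _)) by (unfold gcol; lia).
Qed.

Lemma red_move_legal (v : variant) (k : nat) (h : nat * nat) (p p' : position) :
  turn_at Black k = Red -> pturn p = Red -> (forall t, pboard p t = board_with (used k) h t) ->
  pturn p' = Black -> (forall t, pboard p' t = board_with (used (S k)) h t) ->
  legal v p (rmove (gcol k)) p'.
Proof.
  intros Hk T Hp T' Hp'. apply (rmove_legal v (used k) h); auto using gcol_gadget, used_fresh.
  intros t. rewrite Hp'. cbn [used]. unfold turn_at in Hk. now destruct (Nat.even k).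
Qed.

Lemma play_red (sB sR : strategy) (k : nat) : turn_at Black k = Red ->
  play_move sB sR Black k = sR (hist sB sR Black k).
Proof. intros H. unfold play_move. now rewrite H. Qed.

Lemma play_black (sB sR : strategy) (k : nat) : turn_at Black k = Black ->
  play_move sB sR Black k = sB (hist sB sR Black k).
Proof. intros H. unfold play_move. now rewrite H. Qed.

Lemma play_red_strategy (sB : strategy) (k : nat) : turn_at Black k = Red ->
  play_move sB red_strategy Black k = rmove (gcol k).
Proof. intros H. rewrite play_red by assumption. unfold red_strategy. now rewrite hist_length. Qed.

Lemma inB_start : inB 8 8 = true.
Proof.
  destruct (core_safe 0) as (a & b & E & I & _). rewrite (proj1 core_walk) in E.
  now injection E as <- <-.
Qed.

Lemma red_move_det (v : variant) (k : nat) (h : nat * nat) (p p' : position) :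
  turn_at Black k = Red -> pturn p = Red -> (forall t, pboard p t = board_with (used k) h t) ->
  legal v p (rmove (gcol k)) p' -> forall t, pboard p' t = board_with (used (S k)) h t.
Proof.
  intros Hk T Hp ((c & kd) & Es & Ec & _ & L) t. cbn [mfrom rmove] in *.
  destruct L as [(J & _)|(_ & _ & _ & _ & [(n & En & HB & _)|(I & _)])].
  - discriminate.
  - rewrite HB. destruct (cell_gadget (used k) h (gcol k) (gcol_gadget k)) as (_ & _ & E6).
    rewrite used_fresh in E6 by lia. rewrite Hp, board_with_sq, E6 in Es. injection Es as <- <-.
    destruct n as [|n]; [discriminate|].
    assert (E : jstate (pboard p) (sq (gcol k) (-6)) (Red, Pawn) (mpath (rmove (gcol k))) (S n) =
                jstate (pboard p) (sq (gcol k) (-6)) (Red, Pawn) (mpath (rmove (gcol k))) 1).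
    { clear En HB. induction n as [|n IH]; [reflexivity|]. rewrite <- IH. reflexivity. }
    rewrite E. cbn [jstate fst snd mpath rmove].
    rewrite (gadget_jump (used k) h); auto using gcol_gadget, used_fresh.
    cbn [used]. unfold turn_at in Hk. now destruct (Nat.even k).
  - now destruct (I 1).
Qed.

Lemma red_never_loses (v : variant) (sB : strategy) : ~ loses v start sB red_strategy Red.
Proof.
  intros (n & ps & P0 & L & T & N). cbn [pturn start] in *.
  assert (I : forall k, k <= n -> pturn (ps k) = turn_at Black k /\
    exists h, inB (fst h) (snd h) = true /\ forall t, pboard (ps k) t = board_with (used k) h t).
  { induction k as [|k IH]; intros Hk.
    - rewrite P0. split; [reflexivity|]. exists (8, 8). split; [apply inB_start|reflexivity].
    - destruct (IH ltac:(lia)) as (Tk & h & Ih & Bh). specialize (L k ltac:(lia)).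
      split; [now rewrite turn_at_succ, <- Tk; apply (legal_turn _ _ _ _ L)|].
      destruct (turn_at Black k) eqn:Et.
      + destruct (black_legal v _ h _ _ _ Ih Bh Tk L) as (h' & _ & I' & _ & _ & _ & _ & _ & B').
        exists h'. split; [assumption|]. cbn [used]. unfold turn_at in Et.
        now destruct (Nat.even k).
      + exists h. split; [assumption|]. rewrite play_red_strategy in L by assumption.
        eapply red_move_det; eauto. }
  destruct (I n (le_n n)) as (Tn & h & Ih & Bh). rewrite T in Tn.
  apply N. rewrite play_red_strategy by auto.
  exists (mkPosition (board_with (used (S n)) h) Black). eapply red_move_legal; eauto.
Qed.

Lemma board_with_agree (U : Z -> bool) (h : nat * nat) : agree (board_with U h) h.
Proof.
  split.
  - intros x y. unfold sqn. now rewrite !board_with_sq, !cell_Q.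
  - intros s c k E. destruct (board_with_piece _ _ _ _ E) as (u & v & ->). rewrite board_with_sq in E.
    destruct c; [apply cell_black in E|apply cell_red in E]; tauto.
Qed.

Lemma bmove_agree (v : variant) (h h' : nat * nat) (p p' : position) :
  succ_of h h' -> inB (fst h) (snd h) = true -> inB (fst h') (snd h') = true ->
  agree (pboard p) h -> legal v p (bmove h h') p' -> agree (pboard p') h'.
Proof.
  intros S I I' [H1 H2] (pc & Es & _ & _ & L). cbn [mfrom bmove] in *.
  destruct h' as [a' b']. rewrite H1, (board_with_inB _ h (a', b')) in Es by eauto using succ_of_neq.
  injection Es as <-.
  destruct L as [(_ & (d & H0 & _ & _ & _ & HB) & _)|(J & _)]; [|discriminate].
  cbn in H0. injection H0 as <-. rewrite succ_shift in HB by assumption. split.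
  - intros x y. rewrite HB. apply upd_hole; auto using succ_of_neq.
  - intros s c k. rewrite HB. unfold upd.
    destruct (sq_eqb_spec s (sqn h)); [congruence|].
    destruct (sq_eqb_spec s (sqn (a', b'))); [congruence|eauto].
Qed.

Lemma safe_inB (h : nat * nat) : safe h -> inB (fst h) (snd h) = true.
Proof. intros (a & b & -> & I & _). exact I. Qed.

Lemma core_succ (t : nat) : succ_of (core t) (core (S t)).
Proof. exact (proj2 core_walk t). Qed.

Lemma core_never_loses (v : variant) (sR : strategy) : ~ loses v start core_strategy sR Black.
Proof.
  intros (n & ps & P0 & L & T & N). cbn [pturn start] in *.
  (* Black moves at even times, so after [k] moves the hole has moved [(k + 1) / 2] times, rounded
     down. *)
  set (h := fun k => core (S k / 2)).
  assert (Hsafe : forall k, safe (h k)) by (intros; apply core_safe).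
  assert (Heven : forall k, turn_at Black k = Black ->
            exists t, k = 2 * t /\ h k = core t /\ h (S k) = core (S t)).
  { intros k Hk. unfold turn_at in Hk. destruct (Nat.even k) eqn:E; [|discriminate].
    apply Nat.even_spec in E as [t ->]. exists t. unfold h. repeat split.
    - f_equal. symmetry. apply (Nat.div_unique _ 2 _ 1); lia.
    - f_equal. symmetry. apply (Nat.div_unique _ 2 _ 0); lia. }
  assert (Hodd : forall k, turn_at Black k = Red -> h (S k) = h k).
  { intros k Hk. unfold turn_at in Hk. destruct (Nat.even k) eqn:E; [discriminate|].
    rewrite <- Nat.negb_odd in E. apply negb_false_iff, Nat.odd_spec in E as [t ->].
    unfold h. f_equal. transitivity (S t); [symmetry|].
    - apply (Nat.div_unique _ 2 _ 1); lia.
    - apply (Nat.div_unique _ 2 _ 0); lia. }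
  assert (Hmove : forall k, turn_at Black k = Black ->
            play_move core_strategy sR Black k = bmove (h k) (h (S k)) /\ succ_of (h k) (h (S k))).
  { intros k Hk. rewrite play_black by assumption. unfold core_strategy. rewrite hist_length.
    destruct (Heven k Hk) as (t & -> & -> & ->). rewrite div2_even.
    split; [reflexivity|apply core_succ]. }
  assert (I : forall k, k <= n -> pturn (ps k) = turn_at Black k /\ agree (pboard (ps k)) (h k) /\
    (forced_jump v -> exists U, (exists M, forall l, M <= l -> U (gcol l) = false) /\
       forall t, pboard (ps k) t = board_with U (h k) t)).
  { induction k as [|k IH]; intros Hk.
    - rewrite P0. split; [reflexivity|]. replace (h 0) with (8, 8) by (symmetry; apply core_walk).
      split; [apply board_with_agree|]. intros _. exists (fun _ => false). split; [now exists 0|reflexivity].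
    - destruct (IH ltac:(lia)) as (Tk & Ag & Ex). specialize (L k ltac:(lia)).
      split; [now rewrite turn_at_succ, <- Tk; apply (legal_turn _ _ _ _ L)|].
      destruct (turn_at Black k) eqn:Et.
      + destruct (Hmove k Et) as [Em Sk]. rewrite Em in L. split.
        * apply (bmove_agree v (h k) _ (ps k)); auto using safe_inB.
        * intros F. destruct (Ex F) as (U & Fin & B). exists U. split; [assumption|].
          destruct (black_legal v _ _ _ _ _ (safe_inB _ (Hsafe k)) B Tk L)
            as (h' & _ & _ & E & _ & _ & _ & _ & B').
          cbn in E. apply sqn_inj in E. now rewrite E.
      + rewrite (Hodd k Et). split; [eapply red_legal_agree; eauto|].
        intros F. destruct (Ex F) as (U & (M & Fin) & B).
        assert (Free : exists c, gadget c /\ U c = false).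
        { exists (gcol M). split; [apply gcol_gadget|now apply Fin]. }
        destruct (red_legal_forced v U (h k) (ps k) (ps (S k)) _ F Free (Hsafe k) B Tk L)
          as (c & G & _ & B').
        (* Since [l < gcol l], no index from this bound on belongs to the column just used. *)
        exists (use U c). split; [|assumption]. exists (M + Z.to_nat c). intros l Hl. unfold use.
        rewrite (proj2 (Z.eqb_neq _ _)); [apply Fin; lia|]. unfold gcol, gadget in *. lia. }
  destruct (I n (le_n n)) as (Tn & Ag & Ex). rewrite T in Tn. symmetry in Tn.
  destruct (Hmove n Tn) as [Em Sn]. apply N. rewrite Em.
  apply bmove_legal; auto.
  - rewrite (surjective_pairing (h (S n))), (proj1 Ag), <- surjective_pairing.
    apply board_with_inB; auto using succ_of_neq, safe_inB.
  - rewrite (surjective_pairing (h n)) at 1. rewrite (proj1 Ag), <- surjective_pairing.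
    apply board_with_hole.
  - intros F. destruct (Ex F) as (U & _ & B).
    apply (no_black_jump_available U (h n)); auto using safe_inB.
Qed.

Definition sqn_inv (s : square) : nat * nat :=
  (Z.to_nat ((fst s - snd s) / 2), Z.to_nat (- (fst s + snd s) / 2)).

Lemma sqn_inv_sqn (h : nat * nat) : sqn_inv (sqn h) = h.
Proof.
  destruct h as [a b]. unfold sqn_inv, sqn, sq. cbn [fst snd]. f_equal; lia.
Qed.

(** The new hole is the square that Black's pawn leaves, so it can be decoded from any proposed move
    before its legality is known. *)
Fixpoint hole_at (sB : strategy) (k : nat) : nat * nat :=
  match k with
  | 0 => (8, 8)
  | S k => if Nat.even k then sqn_inv (mfrom (play_move sB red_strategy Black k)) else hole_at sB k
  end.

(** If all moves so far are legal, they form a play as in [loses], and not losing it makes Black's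
    next move legal. Moves are compared through [enc_move] because their paths are functions. *)
Lemma black_plays_forever (v : variant) (sB : strategy) :
  ~ loses v start sB red_strategy Black ->
  let w t := hole_at sB (2 * t) in
  walk w /\ (forall t, inB (fst (w t)) (snd (w t)) = true) /\
  forall t n, enc_move (play_move sB red_strategy Black (2 * t)) n = enc_move (bmove (w t) (w (S t))) n.
Proof.
  intros NL w.
  set (ps := fun k => mkPosition (board_with (used k) (hole_at sB k)) (turn_at Black k)).
  assert (St : forall k, inB (fst (hole_at sB k)) (snd (hole_at sB k)) = true ->
     (forall j, j < k -> legal v (ps j) (play_move sB red_strategy Black j) (ps (S j))) ->
     inB (fst (hole_at sB (S k))) (snd (hole_at sB (S k))) = true /\
     legal v (ps k) (play_move sB red_strategy Black k) (ps (S k)) /\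
     (turn_at Black k = Black -> succ_of (hole_at sB k) (hole_at sB (S k)) /\
        forall n, enc_move (play_move sB red_strategy Black k) n =
                  enc_move (bmove (hole_at sB k) (hole_at sB (S k))) n)).
  { intros k I L. destruct (turn_at Black k) eqn:Et.
    - assert (Ev : Nat.even k = true) by (unfold turn_at in Et; now destruct (Nat.even k)).
      assert (HL : exists p', legal v (ps k) (play_move sB red_strategy Black k) p').
      { apply NNPP. intros N. apply NL. exists k, ps. repeat split; auto. }
      destruct HL as (p' & HL).
      destruct (black_legal v (used k) (hole_at sB k) (ps k) _ _ I (fun _ => eq_refl) Et HL)
        as (h' & S' & I' & E1 & E2 & E3 & E4 & T' & B').
      assert (Eh : hole_at sB (S k) = h').
      { cbn [hole_at]. now rewrite Ev, E1, sqn_inv_sqn. }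
      rewrite Eh. repeat split; auto.
      + apply legal_ext with p'; auto.
        * cbn [pturn ps]. rewrite turn_at_succ, Et. now rewrite T'.
        * intros t. rewrite B'. cbn [pboard ps used]. now rewrite Ev, Eh.
      + intros [|[|[|n]]]; cbn [enc_move bmove mfrom mjump mpath].
        * now rewrite E1.
        * now rewrite E2.
        * now rewrite E3.
        * now rewrite E4.
    - assert (Ev : Nat.even k = false) by (unfold turn_at in Et; now destruct (Nat.even k)).
      assert (Eh : hole_at sB (S k) = hole_at sB k) by (cbn [hole_at]; now rewrite Ev).
      rewrite Eh. repeat split; auto; try discriminate.
      rewrite play_red_strategy by assumption.
      apply (red_move_legal v k (hole_at sB k)); auto.
      + cbn [pturn ps]. now rewrite turn_at_succ, Et.
      + intros t. cbn [pboard ps]. now rewrite Eh. }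
  assert (All : forall k, inB (fst (hole_at sB k)) (snd (hole_at sB k)) = true /\
     (forall j, j < k -> legal v (ps j) (play_move sB red_strategy Black j) (ps (S j)))).
  { induction k as [|k [IH1 IH2]].
    - split; [apply inB_start|lia].
    - destruct (St k IH1 IH2) as (I' & L' & _). split; [assumption|].
      intros j Hj. destruct (Nat.eq_dec j k) as [->|]; [assumption|apply IH2; lia]. }
  assert (HS : forall t, w (S t) = hole_at sB (S (2 * t))).
  { intros t. unfold w. replace (S (2 * t)) with (2 * t + 1) by lia.
    replace (2 * S t) with (S (2 * t + 1)) by lia. cbn [hole_at].
    now rewrite Nat.add_1_r, Nat.even_succ, Nat.odd_mul. }
  assert (HE : forall t, succ_of (w t) (w (S t)) /\
     forall n, enc_move (play_move sB red_strategy Black (2 * t)) n = enc_move (bmove (w t) (w (S t))) n).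
  { intros t. rewrite HS. destruct (All (2 * t)) as [I L].
    apply (St (2 * t) I L). apply turn_at_even. }
  repeat split.
  - intros t. apply HE.
  - intros t. apply (proj1 (All (2 * t))).
  - intros t. apply HE.
Qed.

(** * Computability of the position and of the play *)

Lemma comp_inB (f g : nat -> nat) : comp f -> comp g -> comp (fun x => Nat.b2n (inB (f x) (g x))).
Proof. exact (comp_comp2 (fun a b => Nat.b2n (inB a b)) f g comp2_inB). Qed.

(** [zpos] and [zneg] extract the positive and the negative part of an integer from its code under
    [enc_Z], which is even exactly for nonnegative integers. *)
Definition zpos (a : nat) : nat := if a mod 2 =? 0 then a / 2 else 0.
Definition zneg (a : nat) : nat := if a mod 2 =? 0 then 0 else (a + 1) / 2.

Lemma comp_zpos : comp zpos.
Proof. unfold zpos. comp_auto. Qed.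
Lemma comp_zneg : comp zneg.
Proof. unfold zneg. comp_auto. Qed.
#[export] Hint Resolve comp_zpos comp_zneg : comp.

Lemma enc_Z_nonneg (z : Z) : (0 <= z)%Z -> enc_Z z = 2 * Z.to_nat z.
Proof. intros H. unfold enc_Z. rewrite (proj2 (Z.leb_le 0 z)) by assumption. lia. Qed.

Lemma enc_Z_neg (z : Z) : (z < 0)%Z -> enc_Z z = 2 * Z.to_nat (- z) - 1.
Proof. intros H. unfold enc_Z. rewrite (proj2 (Z.leb_gt 0 z)) by assumption. lia. Qed.

Lemma zpos_enc (z : Z) : zpos (enc_Z z) = Z.to_nat z /\ zneg (enc_Z z) = Z.to_nat (- z).
Proof.
  unfold zpos, zneg. destruct (Z.le_gt_cases 0 z) as [H|H].
  - rewrite enc_Z_nonneg, mod2_even, div2_even by assumption. cbn. lia.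
  - rewrite enc_Z_neg by assumption.
    replace (2 * Z.to_nat (- z) - 1) with (2 * (Z.to_nat (- z) - 1) + 1) by lia.
    rewrite mod2_odd. cbn [Nat.eqb].
    replace (2 * (Z.to_nat (- z) - 1) + 1 + 1) with (2 * Z.to_nat (- z)) by lia.
    rewrite div2_even. lia.
Qed.

(* With [s = sq u v], [A - A' = 2 * u] and [C - C' = 2 * v]. *)
Definition start_content (z : nat) : nat :=
  let A := zpos (pi1 z) + zneg (pi2 z) in let A' := zneg (pi1 z) + zpos (pi2 z) in
  let C := zneg (pi1 z) + zneg (pi2 z) in let C' := zpos (pi1 z) + zpos (pi2 z) in
  if (A + A') mod 2 =? 0 then
    if A' <=? A then
      if C' <=? C then
        if ((A - A') / 2 =? 8) && ((C - C') / 2 =? 8) then 0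
        else if inB ((A - A') / 2) ((C - C') / 2) then 1 else 3
      else if ((A - A') / 2) mod 3 =? 0 then
        if (C' - C) / 2 =? 4 then 0 else if (C' - C) / 2 =? 5 then 1 else 3
      else 3
    else 3
  else 0.

Lemma comp_start_content : comp start_content.
Proof.
  unfold start_content. cbv zeta.
  repeat match goal with
  | |- comp (fun x => if inB (@?f x) (@?g x) then @?a x else @?b x) =>
      apply (comp_if (fun x => inB (f x) (g x)) a b); [apply (comp_inB f g)|..]
  | |- comp (fun x => if @?c x then @?a x else @?b x) => apply (comp_if c a b)
  end; comp_auto.
Qed.

Lemma start_content_spec (s : square) :
  start_content (enc_sq s) = enc_content (pboard start s).
Proof.
  destruct s as [x y]. unfold start_content, enc_sq. cbn [fst snd pboard start].
  rewrite pi1_cp, pi2_cp.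
  destruct (zpos_enc x) as [-> ->]. destruct (zpos_enc y) as [-> ->]. cbv zeta.
  set (A := Z.to_nat x + Z.to_nat (- y)). set (A' := Z.to_nat (- x) + Z.to_nat y).
  set (C := Z.to_nat (- x) + Z.to_nat (- y)). set (C' := Z.to_nat x + Z.to_nat y).
  destruct (classic (dark (x, y))) as [D|D].
  - destruct (dark_sq _ D) as (u & v & E). rewrite E, board_with_sq. unfold sq in E. injection E as E1 E2.
    assert (EA : (Z.of_nat A - Z.of_nat A' = 2 * u)%Z) by (subst A A'; lia).
    assert (EC : (Z.of_nat C - Z.of_nat C' = 2 * v)%Z) by (subst C C'; lia).
    clearbody A A' C C'.
    assert (Em : (A + A') mod 2 = 0) by lia. rewrite Em. cbn [Nat.eqb].
    unfold cell.
    destruct (Nat.leb_spec A' A) as [LA|LA].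
    + rewrite (proj2 (Z.leb_le 0 u)) by lia.
      assert (HU : (A - A') / 2 = Z.to_nat u) by lia. rewrite HU.
      destruct (Nat.leb_spec C' C) as [LC|LC].
      * rewrite (proj2 (Z.leb_le 0 v)) by lia.
        assert (HV : (C - C') / 2 = Z.to_nat v) by lia. rewrite HV. cbn [andb fst snd].
        destruct ((Z.to_nat u =? 8) && (Z.to_nat v =? 8)); [reflexivity|].
        now destruct (inB (Z.to_nat u) (Z.to_nat v)).
      * rewrite (proj2 (Z.leb_gt 0 v)) by lia. cbn [andb].
        assert (HV : (C' - C) / 2 = Z.to_nat (- v)) by lia. rewrite HV.
        destruct (Nat.eqb_spec (Z.to_nat u mod 3) 0) as [M|M].
        -- rewrite (proj2 (Z.eqb_eq (u mod 3) 0)) by lia.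
           destruct (Nat.eqb_spec (Z.to_nat (- v)) 4), (Nat.eqb_spec (Z.to_nat (- v)) 5),
             (Z.eqb_spec v (-4)), (Z.eqb_spec v (-5)); try lia; try reflexivity.
           now destruct (Z.eqb_spec v (-6)).
        -- now rewrite (proj2 (Z.eqb_neq (u mod 3) 0)) by lia.
    + rewrite (proj2 (Z.leb_gt 0 u)) by lia. reflexivity.
  - rewrite board_with_dark_only by assumption.
    assert (Em : (A + A') mod 2 <> 0).
    { intros Em. apply D. unfold dark. cbn [fst snd]. apply Z.even_spec. subst A A'.
      exists ((x + y) / 2)%Z. lia. }
    apply Nat.eqb_neq in Em. now rewrite Em.
Qed.

Lemma start_computable : computable_position start.
Proof.
  destruct comp_start_content as [c H]. exists c. intros s. rewrite <- start_content_spec. apply H.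
Qed.

Lemma enc_sq_gcol (l : nat) : enc_sq (sq (gcol l) (-6)) = cp (6 * l + 30) (6 * l + 5).
Proof.
  unfold enc_sq, sq, gcol. cbn [fst snd]. rewrite enc_Z_nonneg, enc_Z_neg by lia.
  f_equal. f_equal; lia.
Qed.

Definition red_enc (l n : nat) : nat :=
  if n =? 0 then cp (6 * l + 30) (6 * l + 5) else if n =? 1 then 1 else if n =? 2 then 4 else 0.

Lemma red_enc_spec (l n : nat) : enc_move (rmove (gcol l)) n = red_enc l n.
Proof.
  destruct n as [|[|[|n]]]; try reflexivity. unfold enc_move, red_enc. cbn [mfrom rmove Nat.eqb].
  apply enc_sq_gcol.
Qed.

Lemma comp2_red_enc : comp2 red_enc.
Proof. unfold red_enc. comp_auto. Qed.
#[export] Hint Resolve comp2_red_enc : comp.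

Lemma red_strategy_computable : computable_strategy red_strategy.
Proof.
  destruct comp2_red_enc as [c H].
  exists (CComp c (CPair (CComp COrc CZero) CId)). intros h n.
  unfold red_strategy. rewrite red_enc_spec.
  apply ev_comp with (cp (length h) n).
  - constructor; [|constructor]. econstructor; [constructor|]. apply (ev_orc (enc_hist h) 0).
  - pose proof (H (enc_hist h) (cp (length h) n)) as K. now rewrite pi1_cp, pi2_cp in K.
Qed.

Definition enc_sqn (a b : nat) : nat :=
  cp (if b <=? a then 2 * (a - b) else 2 * (b - a) - 1) (if a + b =? 0 then 0 else 2 * (a + b) - 1).

Lemma enc_sqn_spec (h : nat * nat) : enc_sq (sqn h) = enc_sqn (fst h) (snd h).
Proof.
  destruct h as [a b]. unfold enc_sq, sqn, sq, enc_sqn. cbn [fst snd]. f_equal. f_equal.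
  - destruct (Nat.leb_spec b a); [rewrite enc_Z_nonneg by lia|rewrite enc_Z_neg by lia]; lia.
  - destruct (Nat.eqb_spec (a + b) 0); [rewrite enc_Z_nonneg by lia|rewrite enc_Z_neg by lia]; lia.
Qed.

Lemma comp2_enc_sqn : comp2 enc_sqn.
Proof. unfold enc_sqn. comp_auto. Qed.
#[export] Hint Resolve comp2_enc_sqn : comp.

(* [s] and [s'] are the codes of the hole before and after Black's move. *)
Definition black_enc (s s' n : nat) : nat :=
  if n =? 0 then enc_sqn (pi1 s') (pi2 s') else if n =? 1 then 0
  else if n =? 2 then if pi1 s' =? pi1 s then 1 else 2 else 0.

Lemma comp3_black_enc : comp3 black_enc.
Proof. unfold black_enc, comp3. comp_auto. Qed.
#[export] Hint Resolve comp3_black_enc : comp.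

Definition cph (h : nat * nat) : nat := cp (fst h) (snd h).

Lemma black_enc_spec (h h' : nat * nat) (n : nat) :
  enc_move (bmove h h') n = black_enc (cph h) (cph h') n.
Proof.
  unfold black_enc, cph. rewrite !pi1_cp, !pi2_cp.
  destruct n as [|[|[|n]]]; try reflexivity.
  - apply enc_sqn_spec.
  - unfold enc_move, bmove, bdir. cbn [mpath Nat.eqb]. now destruct (_ =? _).
Qed.

(** The whole past of the walk in one number, newest position outermost, so that primitive recursion
    can extend it. *)
Fixpoint trace (w : nat -> nat * nat) (t : nat) : nat :=
  match t with 0 => cp (cph (w 0)) 0 | S t => cp (cph (w (S t))) (trace w t) end.

Definition look (L d : nat) : nat := pi1 (nat_rect (fun _ => nat) L (fun _ y => pi2 y) d).

Lemma comp2_look : comp2 look.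
Proof. unfold look, comp2. comp_auto. Qed.
#[export] Hint Resolve comp2_look : comp.

Lemma look_trace (w : nat -> nat * nat) (t d : nat) : d <= t -> look (trace w t) d = cph (w (t - d)).
Proof.
  intros H. unfold look.
  assert (E : nat_rect (fun _ => nat) (trace w t) (fun _ y => pi2 y) d = trace w (t - d)).
  { induction d as [|d IH]; cbn; [now rewrite Nat.sub_0_r|]. rewrite IH by lia.
    replace (t - d) with (S (t - S d)) by lia. cbn [trace]. apply pi2_cp. }
  rewrite E. destruct (t - d); cbn [trace]; apply pi1_cp.
Qed.

(** Even moves are Black's and are recovered from two consecutive holes; odd ones depend on their
    index alone. The value 0 past the end is the encoding of the default [dmove]. *)
Definition hist_enc (q x : nat) : nat :=
  let t := pi1 q in let L := pi2 q in
  if x =? 0 then 2 * t else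
  let i := pi1 (x - 1) in let n := pi2 (x - 1) in
  if i <? 2 * t then
    if i mod 2 =? 0 then black_enc (look L (t - i / 2)) (look L (t - (i / 2 + 1))) n
    else red_enc i n
  else 0.

Lemma comp2_hist_enc : comp2 hist_enc.
Proof. unfold hist_enc, comp2. cbv zeta. comp_auto. Qed.

Lemma nth_hist (sB sR : strategy) (n i : nat) :
  i < n -> nth i (hist sB sR Black n) dmove = play_move sB sR Black i.
Proof.
  induction n as [|n IH]; intros H; [lia|]. cbn [hist].
  destruct (Nat.eq_dec i n) as [->|].
  - rewrite app_nth2; rewrite hist_length; [|lia]. now rewrite Nat.sub_diag.
  - rewrite app_nth1 by (rewrite hist_length; lia). apply IH. lia.
Qed.

Lemma enc_dmove (n : nat) : enc_move dmove n = 0.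
Proof. now destruct n as [|[|n]]. Qed.

Lemma hist_enc_spec (sB : strategy) (w : nat -> nat * nat) :
  (forall t n, enc_move (play_move sB red_strategy Black (2 * t)) n =
               enc_move (bmove (w t) (w (S t))) n) ->
  forall t x, enc_hist (hist sB red_strategy Black (2 * t)) x = hist_enc (cp t (trace w t)) x.
Proof.
  intros Hw t x. unfold hist_enc. rewrite pi1_cp, pi2_cp. cbv zeta.
  destruct x as [|x]; cbn [enc_hist Nat.eqb].
  - apply hist_length.
  - replace (S x - 1) with x by lia. unfold pi1 at 1 2 3 4 5, pi2 at 1 2.
    destruct (Cantor.of_nat x) as [i n]. cbn [fst snd].
    destruct (Nat.ltb_spec i (2 * t)) as [L|L].
    + rewrite nth_hist by assumption. pose proof (Nat.div_mod_eq i 2) as E.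
      destruct (Nat.eqb_spec (i mod 2) 0) as [M|M].
      * rewrite !look_trace by lia.
        replace (t - (t - i / 2)) with (i / 2) by lia.
        replace (t - (t - (i / 2 + 1))) with (S (i / 2)) by lia.
        rewrite <- black_enc_spec, <- Hw. now replace (2 * (i / 2)) with i by lia.
      * rewrite play_red_strategy; [apply red_enc_spec|].
        replace i with (2 * (i / 2) + 1) by lia. apply turn_at_odd.
    + rewrite nth_overflow by (now rewrite hist_length). apply enc_dmove.
Qed.

(** The history before Black's next move depends only on the trace up to now. Feeding it to Black's
    code in place of the oracle yields the next direction, which extends the trace. *)
Lemma walk_computable (sB : strategy) (w : nat -> nat * nat) :
  walk w -> computable_strategy sB ->
  (forall t n, enc_move (play_move sB red_strategy Black (2 * t)) n =
               enc_move (bmove (w t) (w (S t))) n) ->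
  comp (fun t => cp (fst (w t)) (snd (w t))).
Proof.
  intros [W0 WS] [c Hc] Hw.
  destruct (oracle_subst hist_enc c comp2_hist_enc) as [c' Hc'].
  set (next := fun z => let L := pi2 (pi2 (pi1 z)) in let s := pi1 L in
     cp (if pi2 z =? 1 then cp (pi1 s) (S (pi2 s)) else cp (S (pi1 s)) (pi2 s)) L).
  assert (Cn : comp next).
  { unfold next. cbv zeta. comp_auto. }
  (* Entry 2 of an encoded move is its first direction: 1 is [NE], upon which the second coordinate
     of the hole grows, and 2 is [NW], upon which the first does. *)
  assert (Ci : comp (fun z => cp (pi2 z) 2)) by comp_arith.
  destruct Cn as [cn Hn]. destruct Ci as [ci Hi].
  destruct (comp_const (trace w 0)) as [c0 H0].
  set (cg := CComp cn (CPair CId (CComp c' ci))).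
  assert (Hg : forall o a t, ev o cg (cp a (cp t (trace w t))) (trace w (S t))).
  { intros o a t.
    set (val := if fst (w (S t)) =? fst (w t) then 1 else 2).
    assert (Hval : ev o c' (cp (cp t (trace w t)) 2) val).
    { apply (Hc' (enc_hist (hist sB red_strategy Black (2 * t)))).
      - now apply hist_enc_spec.
      - replace val with (enc_move (sB (hist sB red_strategy Black (2 * t))) 2); [apply Hc|].
        rewrite <- (play_black sB red_strategy) by apply turn_at_even.
        rewrite Hw, black_enc_spec. unfold black_enc, cph. cbn [Nat.eqb]. now rewrite !pi1_cp. }
    apply ev_comp with (cp (cp a (cp t (trace w t))) val).
    - constructor; [constructor|]. econstructor; [apply Hi|]. now rewrite pi2_cp.
    - replace (trace w (S t)) with (next (cp (cp a (cp t (trace w t))) val)); [apply Hn|].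
      unfold next. cbv zeta. rewrite !pi1_cp, !pi2_cp. cbn [trace]. f_equal. f_equal.
      assert (E : pi1 (trace w t) = cph (w t)).
      { pose proof (look_trace w t 0 ltac:(lia)) as E. now rewrite Nat.sub_0_r in E. }
      rewrite E. unfold val, cph. rewrite pi1_cp, pi2_cp.
      destruct (WS t) as [E'|E']; rewrite E'; cbn [fst snd].
      + replace (S (fst (w t)) =? fst (w t)) with false; [reflexivity|].
        symmetry. apply Nat.eqb_neq. lia.
      + now rewrite Nat.eqb_refl. }
  assert (Ct : comp (trace w)).
  { exists (CComp (CRec c0 cg) (CPair CId CId)). intros o t.
    apply ev_comp with (cp t t); [repeat constructor|].
    enough (forall a, ev o (CRec c0 cg) (cp a t) (trace w t)) by auto. intros a.
    induction t as [|t IH].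
    - constructor. apply H0.
    - econstructor; [exact IH|apply Hg]. }
  apply comp_ext with (fun t => pi1 (trace w t)); [|now apply (comp_comp pi1); auto with comp].
  intros t. pose proof (look_trace w t 0 ltac:(lia)) as E. now rewrite Nat.sub_0_r in E.
Qed.

Theorem theorem4 : forall v : variant,
  exists p0 : position,
    dark_only (pboard p0) /\ computable_position p0 /\
    (exists sR : strategy,
       computable_strategy sR /\
       (forall sB : strategy, computable_strategy sB -> loses v p0 sB sR Black) /\
       (forall sB : strategy, ~ loses v p0 sB sR Red)) /\
    (exists sB : strategy, forall sR : strategy, ~ loses v p0 sB sR Black).
Proof.
  intros v. exists start. split; [apply board_with_dark_only|]. split; [apply start_computable|]. split.
  - exists red_strategy. split; [apply red_strategy_computable|]. split.
    + intros sB CB. apply NNPP. intros NL.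
      destruct (black_plays_forever v sB NL) as (Hw & HB & HE).
      apply (walk_no_computable _ Hw HB). exact (walk_computable sB _ Hw CB HE).
    + apply red_never_loses.
  - exists core_strategy. apply core_never_loses.
Qed.
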